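(* The problem WPPSG$_1$ can be solved efficiently (in polynomial time).
   Context: $\mathcal{S}_n$ is the symmetric group on $[n]=\{1,\ldots,n\}$, products composed left to right; for $X\subseteq[n]$, $\mathcal{S}_X$ is the subgroup of permutations fixing every element of $[n]\setminus X$. WPPSG: given integers $n,m\ge1$, sets $X_1,\ldots,X_m\subseteq[n]$ and $\tau_0\in\mathcal{S}_n$, decide whether there exist $\sigma_j\in\mathcal{S}_{X_j}$ ($j=1,\ldots,m$) with $\tau_0=\sigma_1\cdots\sigma_m$. WPPSG$_1$ is the restriction of WPPSG to instances whose sets $X_1,\ldots,X_m$ have the consecutive ones property: there is a permutation $\pi$ of $[n]$ such that, writing $\pi$ as the sequence $(1\pi,\ldots,n\pi)$, the elements of each $X_j$ occur in consecutive positions. *)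

(* Defs.v *)
From HB Require Import structures.
From mathcomp Require Import all_boot all_fingroup.

Set Implicit Arguments.
Unset Strict Implicit.
Unset Printing Implicit Defensive.

Inductive move := MoveL | MoveN | MoveR.

(* A two-way infinite tape over a type with a blank: the cells left of the
   head (nearest first), the scanned cell, the cells right of the head
   (nearest first); all cells beyond the two lists are blank. *)
Record tape (A : Type) := Tape {
  tape_left : seq (option A);
  tape_head : option A;
  tape_right : seq (option A)
}.

Definition blank_tape (A : Type) : tape A := Tape [::] None [::].

Definition input_tape (A : Type) (w : seq A) : tape A :=
  Tape [::] (ohead w) (map some (behead w)).

Definition tape_write (A : Type) (a : option A) (t : tape A) : tape A :=
  Tape (tape_left t) a (tape_right t).

Definition tape_move (A : Type) (d : move) (t : tape A) : tape A :=
  let: Tape l a r := t in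
  match d with
  | MoveL => Tape (behead l) (head None l) (a :: r)
  | MoveN => t
  | MoveR => Tape (a :: l) (head None r) (behead r)
  end.

(* The tape alphabet consists of the input alphabet [S], the auxiliary symbols
   [tm_aux] and the blank [None]. There are [tm_tapes.+1] tapes; tape [ord0]
   holds the input. [tm_halt q = Some b] means that [q] is a halting state, with
   verdict "accept" ([b = true]) or "reject" ([b = false]). *)
Record turing_machine (S : finType) := TuringMachine {
  tm_tapes : nat;
  tm_aux : finType;
  tm_state : finType;
  tm_start : tm_state;
  tm_halt : tm_state -> option bool;
  tm_trans :
    tm_state -> {ffun 'I_tm_tapes.+1 -> option (S + tm_aux)} ->
    tm_state * ('I_tm_tapes.+1 -> option (S + tm_aux) * move)
}.

Section Run.
Variables (S : finType) (M : turing_machine S).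

Definition tm_config : Type :=
  tm_state M * {ffun 'I_(tm_tapes M).+1 -> tape (S + tm_aux M)}.

Definition tm_init (w : seq S) : tm_config :=
  (tm_start M,
   [ffun i => if i == ord0 then input_tape (map inl w)
              else blank_tape (S + tm_aux M)]).

Definition tm_step (c : tm_config) : tm_config :=
  if tm_halt c.1 is Some _ then c else
  let: (q, act) := tm_trans c.1 [ffun i => tape_head (c.2 i)] in
  (q, [ffun i => tape_move (act i).2 (tape_write (act i).1 (c.2 i))]).

(* Halting configurations are fixed by [tm_step], so this is the verdict of [M]
   on [w] if [M] halts after at most [t] steps, and [None] otherwise. *)
Definition tm_verdict (w : seq S) (t : nat) : option bool :=
  tm_halt (iter t tm_step (tm_init w)).1.

End Run.

Record decision_problem := DecisionProblem {
  instance : Type;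
  alphabet : finType;
  encode : instance -> seq alphabet;
  yes_instance : instance -> Prop
}.

Definition restrict (P : decision_problem) (D : instance P -> Prop) :
    decision_problem :=
  {| instance := {x : instance P | D x};
     alphabet := alphabet P;
     encode := fun x => encode (sval x);
     yes_instance := fun x => yes_instance (sval x) |}.

(* Any polynomial is bounded by one of the form [c * s ^ d + c]. *)
Definition polytime_solvable (P : decision_problem) : Prop :=
  exists (M : turing_machine (alphabet P)) (c d : nat),
    forall x : instance P,
      exists2 b : bool,
        tm_verdict M (encode x) (c * size (encode x) ^ d + c) = Some b
        & b <-> yes_instance x.

(* The element [i.+1] of [n] = {1, ..., n} is represented by [i : 'I_n]. *)
Record wppsg_instance := WppsgInstance {
  wp_n : nat;
  wp_m : nat;
  wp_n_gt0 : 0 < wp_n;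
  wp_m_gt0 : 0 < wp_m;
  wp_set : 'I_wp_m -> {set 'I_wp_n};
  wp_target : 'S_wp_n
}.

(* In [{perm T}] products are composed from left to right: [permM]. *)
Definition wppsg_yes (x : wppsg_instance) : Prop :=
  exists sigma : 'I_(wp_m x) -> 'S_(wp_n x),
    (forall j, sigma j \in Sym (wp_set j)) /\
    wp_target x = (\prod_(j < wp_m x) sigma j)%g.

Definition symbol : finType := (bool + bool)%type.
Definition digit (b : bool) : symbol := inl b.
Definition comma : symbol := inr false.
Definition semicolon : symbol := inr true.

(* Binary digits of [k], least significant digit first, without leading zeros
   (and [binary 0 = [:: false]]). *)
Definition binary (k : nat) : seq bool :=
  mkseq (fun i => odd (k %/ 2 ^ i)) (trunc_log 2 k).+1.

Definition encode_nat (k : nat) : seq symbol := rcons (map digit (binary k)) comma.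

Definition encode_list (s : seq nat) : seq symbol :=
  rcons (flatten (map encode_nat s)) semicolon.

(* An instance is written "n,m;1 tau,...,n tau;X_1;...;X_m;", each set being
   written as the increasing list of its elements. *)
Definition wppsg_encode (x : wppsg_instance) : seq symbol :=
  encode_list [:: wp_n x; wp_m x]
  ++ encode_list [seq (wp_target x i).+1 | i <- enum 'I_(wp_n x)]
  ++ flatten [seq encode_list [seq i.+1 | i : 'I_(wp_n x) <- enum (wp_set j)]
             | j <- enum 'I_(wp_m x)].

Definition WPPSG : decision_problem :=
  {| instance := wppsg_instance;
     alphabet := symbol;
     encode := wppsg_encode;
     yes_instance := wppsg_yes |}.

(* [pi p] is the element in position [p] of the sequence (1 pi, ..., n pi). *)
Definition consecutive_ones (x : wppsg_instance) : Prop :=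
  exists pi : 'S_(wp_n x), forall (j : 'I_(wp_m x)) (p q r : 'I_(wp_n x)),
    p <= q <= r -> pi p \in wp_set j -> pi r \in wp_set j -> pi q \in wp_set j.

Definition WPPSG1 : decision_problem := restrict (P := WPPSG) consecutive_ones.

(* Main.v *)
(* Call [x < y] forced by [z < y] when some set contains [x] and [z] but not
   [y]. Adding an arbitrary incomparable pair to a partial order closed under
   forcing and then closing under forcing and transitivity creates no cycle when
   a consecutive ordering exists: the forcing class of the pair is antisymmetric,
   and the triangle lemma shows that it is transitive and absorbs the pairs of
   the old order between two of its own. Repeating this yields a linear order in
   which all sets are intervals.

   For intervals, the products of the groups S_{X_1}, ..., S_{X_m} form a set
   closed under swapping two values that are out of order. Hence one may replace
   the target by the permutation sorted inside X_1, drop X_1, and continue; the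
   answer is yes iff the identity is reached.

   For the running time, the algorithm is written with bounded loops, bit arrays
   and variables that saturate at the input length. Such programs compile to
   stack programs and then to multi-tape Turing machines, with a cost that is
   polynomial by structural induction. *)
Require Import Defs.
From HB Require Import structures.
From mathcomp Require Import all_boot all_fingroup.
From mathcomp Require Import zify.

Set Implicit Arguments.
Unset Strict Implicit.
Unset Printing Implicit Defensive.

(** * Stack programs on Turing machines *)

Section Tapes.
Variable A : Type.
Implicit Types (t : tape A) (l : seq A).

(* The scanned cell is the top of the stack; the cells on its left are junk. *)
Definition holds_stack t l : Prop :=
  nth None (tape_head t :: tape_right t) =1 nth None (map some l).

Lemma holds_stack_head t l : holds_stack t l -> tape_head t = ohead l.
Proof. by move/(_ 0) => /= ->; case: l. Qed.

Lemma holds_stack_push t l x :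
  holds_stack t l ->
  holds_stack (tape_write (Some x) (tape_move MoveL t)) (x :: l).
Proof. by case: t => left a right tl [|i] //=; apply: tl. Qed.

Lemma holds_stack_pop t l :
  holds_stack t l -> holds_stack (tape_move MoveR (tape_write None t)) (behead l).
Proof.
case: t => left a right tl i; move: (tl i.+1) => /=.
have -> : nth None (head None right :: behead right) i = nth None right i.
  by case: right {tl} i => [|b right] [|i] //=; rewrite nth_nil.
by move=> ->; case: l {tl} => //=; rewrite nth_nil.
Qed.

Lemma holds_input_tape l : holds_stack (input_tape l) l.
Proof. by case: l => [|x l] [|i] //=; rewrite nth_nil. Qed.

Lemma holds_blank_tape : holds_stack (blank_tape A) [::].
Proof. by case=> //= i; rewrite !nth_nil. Qed.

End Tapes.

Section StackCode.
Variables (S : finType) (name : eqType) (input : name).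

Definition cell : eqType := (S + bool)%type.
Definition mark (b : bool) : cell := inr b.

Definition tapes := name -> tape cell.
Definition heads (T : tapes) (s : name) : option cell := tape_head (T s).

Inductive instr :=
| GoLeft of name
| Write of name & cell
| Erase of name
| Carry of name & name
| Branch of name & pred (option cell) & nat.

Definition instr_names (i : instr) : seq name :=
  match i with
  | GoLeft s | Write s _ | Erase s | Branch s _ _ => [:: s]
  | Carry s s' => [:: s; s']
  end.

Definition instr_act (i : instr) (h : name -> option cell) (s : name) :
    option cell * move :=
  match i with
  | GoLeft s1 => (h s, if s == s1 then MoveL else MoveN)
  | Write s1 x => (if s == s1 then Some x else h s, MoveN)
  | Erase s1 => if s == s1 then (None, MoveR) else (h s, MoveN)
  | Carry s1 s2 =>
      if s == s2 then (Some (odflt (mark false) (h s1)), MoveN)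
      else if s == s1 then (None, MoveR) else (h s, MoveN)
  | Branch _ _ _ => (h s, MoveN)
  end.

Definition instr_next (i : instr) (h : name -> option cell) (pc : nat) : nat :=
  if i is Branch s f l then (if f (h s) then pc.+1 else l) else pc.+1.

Definition perform (a : name -> option cell * move) (T : tapes) : tapes :=
  fun s => tape_move (a s).2 (tape_write (a s).1 (T s)).

Definition code_step (code : seq instr) (k : nat * tapes) : nat * tapes :=
  if onth code k.1 is Some i
  then (instr_next i (heads k.2) k.1, perform (instr_act i (heads k.2)) k.2) else k.

Lemma eq_instr_act i (h h' : name -> option cell) s :
  {in s :: instr_names i, h =1 h'} -> instr_act i h s = instr_act i h' s.
Proof.
move=> hh'; have hs : h s = h' s by apply: hh'; rewrite inE eqxx.
by case: i hh' => //= [s1 _|s1 x _|s1 _|s1 s2 ->|s1 f l _]; rewrite ?hs // !inE eqxx orbT.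
Qed.

Lemma eq_instr_next i (h h' : name -> option cell) pc :
  {in instr_names i, h =1 h'} -> instr_next i h pc = instr_next i h' pc.
Proof. by case: i => //= s f l -> //; rewrite inE eqxx. Qed.

Section Machine.
Variables (code : seq instr) (output : name) (verdict : pred (option cell)).

Let names := input :: output :: flatten (map instr_names code).
Let K := size names.

Definition tape_ix (s : name) : 'I_K.+1 := inord (index s names).
Definition tape_name (i : 'I_K.+1) : name := nth input names i.

(* All addresses past the end of the code share one state, from which the
   machine halts. *)
Definition pc_state (pc : nat) : 'I_(size code).+1 := inord (minn pc (size code)).

Definition code_machine : turing_machine S :=
  @TuringMachine S K bool ('I_(size code).+1 + bool)%type (inl (pc_state 0))
    (fun q => if q is inr b then Some b else None)
    (fun q reads =>
       let h s := reads (tape_ix s) in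
       let idle i := (reads i, MoveN) in
       match q with
       | inr b => (q, idle)
       | inl pc =>
           if onth code pc is Some ins then
             (inl (pc_state (instr_next ins h pc)),
              fun i => if i == tape_ix (tape_name i)
                       then instr_act ins h (tape_name i) else idle i)
           else (inr (verdict (h output)), idle)
       end).

Definition simulates (c : tm_config code_machine) (k : nat * tapes) : Prop :=
  c.1 = inl (pc_state k.1) /\ forall s, s \in names -> c.2 (tape_ix s) = k.2 s.

Lemma tape_ixK : {in names, cancel tape_ix tape_name}.
Proof.
move=> s s_in; rewrite /tape_name /tape_ix inordK ?nth_index //.
by rewrite ltnS ltnW // index_mem.
Qed.

Lemma pc_stateE pc : pc_state pc = minn pc (size code) :> nat.
Proof. by rewrite inordK // ltnS geq_minr. Qed.

Lemma onth_pc_state pc : onth code (pc_state pc) = onth code pc.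
Proof. by rewrite pc_stateE; case: leqP => // /ltnW le_pc; rewrite !onth_default. Qed.

Lemma onth_names pc i : onth code pc = Some i -> {subset instr_names i <= names}.
Proof.
move=> pc_i s s_i; rewrite !inE; apply/orP; right; apply/orP; right.
elim: (code) pc pc_i => [|j l IH] [|pc] //=; rewrite mem_cat.
  by move=> [->]; rewrite s_i.
by move=> /IH->; rewrite orbT.
Qed.

Lemma simulates_step c k :
  k.1 < size code -> simulates c k -> simulates (tm_step c) (code_step code k).
Proof.
case: k => pc T pc_lt [c_pc cT]; rewrite /= in pc_lt c_pc cT.
have pcE : pc_state pc = pc :> nat by rewrite pc_stateE (minn_idPl (ltnW pc_lt)).
rewrite /code_step /tm_step c_pc /= onth_pc_state.
case pc_i: (onth code pc) => [i|]; last by rewrite -onthTE pc_i in pc_lt.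
pose h s := [ffun j => tape_head (c.2 j)] (tape_ix s).
have hE : {in names, h =1 heads T} by move=> s s_in; rewrite /h ffunE cT.
have names_i := onth_names pc_i.
split=> [|s s_in] /=.
  by rewrite pcE; congr (inl (pc_state _)); apply: eq_instr_next => s /names_i/hE.
rewrite ffunE tape_ixK // eqxx /perform cT // (@eq_instr_act _ _ (heads T)) //.
by move=> s'; rewrite inE => /predU1P[->|/names_i]; apply: hE.
Qed.

Lemma simulates_exit n c k k' :
  simulates c k -> iter n (code_step code) k = k' -> size code <= k'.1 ->
  exists2 n', n' <= n & simulates (iter n' (@tm_step _ code_machine) c) k'.
Proof.
elim: n c k => [|n IH] c k ck; first by move=> <- _; exists 0.
rewrite iterSr => k'E exit; have [k_lt|k_ge] := ltnP k.1 (size code).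
  have [n' n'_le ck'] := IH _ _ (simulates_step k_lt ck) k'E exit.
  by exists n'.+1; rewrite ?iterSr.
have stepK : code_step code k = k by rewrite /code_step onth_default.
rewrite stepK in k'E; have [n' n'_le ck'] := IH _ _ ck k'E exit.
by exists n' => //; apply: leqW.
Qed.

Lemma simulates_verdict c pc T n :
  simulates c (pc, T) -> size code <= pc -> 0 < n ->
  tm_halt (iter n (@tm_step _ code_machine) c).1 = Some (verdict (heads T output)).
Proof.
move=> [c_pc cT] exit; case: n => // n _; elim: n => [|n IH].
  rewrite /= /tm_step c_pc /= onth_pc_state onth_default //= ffunE cT //.
  by rewrite !inE eqxx orbT.
by rewrite iterS /tm_step IH.
Qed.

End Machine.

Definition code_at (code : seq instr) (b : nat) (l : seq instr) : Prop :=
  exists u v, code = u ++ l ++ v /\ size u = b.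

Lemma code_at_catl code b l1 l2 : code_at code b (l1 ++ l2) -> code_at code b l1.
Proof. by move=> [u [v [-> <-]]]; exists u, (l2 ++ v); rewrite -catA. Qed.

Lemma code_at_catr code b l1 l2 :
  code_at code b (l1 ++ l2) -> code_at code (b + size l1) l2.
Proof. by move=> [u [v [-> <-]]]; exists (u ++ l1), v; rewrite size_cat -!catA. Qed.

Lemma code_at_tail code b i l : code_at code b (i :: l) -> code_at code b.+1 l.
Proof. by rewrite -cat1s -addn1; apply: code_at_catr. Qed.

Lemma code_step_at code b i l T :
  code_at code b (i :: l) ->
  code_step code (b, T) = (instr_next i (heads T) b, perform (instr_act i (heads T)) T).
Proof. by move=> [u [v [-> <-]]]; rewrite /code_step onth_cat ltnn subnn. Qed.

Definition stacks := name -> seq cell.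
Definition tapes_hold (T : tapes) (st : stacks) : Prop := forall s, holds_stack (T s) (st s).

Definition set_stack (st : stacks) (s : name) (l : seq cell) : stacks :=
  fun s' => if s' == s then l else st s'.

Lemma tapes_hold_head T st s : tapes_hold T st -> heads T s = ohead (st s).
Proof. by move=> T_st; apply: holds_stack_head. Qed.

Definition reaches code b (st : stacks) B b' (Q : stacks -> Prop) : Prop :=
  forall T, tapes_hold T st -> exists n T' st',
    [/\ n <= B, iter n (code_step code) (b, T) = (b', T'), tapes_hold T' st' & Q st'].

Lemma reaches_refl code b st B (Q : stacks -> Prop) : Q st -> reaches code b st B b Q.
Proof. by move=> Qst T T_st; exists 0, T, st. Qed.

Lemma reaches_trans code b1 b2 b3 st B1 B2 Q :
  reaches code b1 st B1 b2 (fun st' => reaches code b2 st' B2 b3 Q) ->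
  reaches code b1 st (B1 + B2) b3 Q.
Proof.
move=> reach1 T T_st; have [n1 [T1 [st1 [n1_le run1 T1_st1 reach2]]]] := reach1 T T_st.
have [n2 [T2 [st2 [n2_le run2 T2_st2 Qst2]]]] := reach2 T1 T1_st1.
by exists (n2 + n1), T2, st2; rewrite iterD run1 addnC leq_add.
Qed.

Lemma reaches_weaken code b b' st B B' (Q Q' : stacks -> Prop) :
  B <= B' -> (forall st', Q st' -> Q' st') ->
  reaches code b st B b' Q -> reaches code b st B' b' Q'.
Proof.
move=> B_le QQ' reach T /reach[n [T' [st' [n_le run T_st' Qst']]]].
by exists n, T', st'; split=> //; [apply: leq_trans B_le|apply: QQ'].
Qed.

Lemma reaches_branch code b s f l r st B b' Q :
  code_at code b (Branch s f l :: r) ->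
  reaches code (if f (ohead (st s)) then b.+1 else l) st B b' Q ->
  reaches code b st B.+1 b' Q.
Proof.
move=> b_branch reach T T_st; pose T1 := perform (instr_act (Branch s f l) (heads T)) T.
have T1_st : tapes_hold T1 st.
  by move=> s'; have := T_st s'; rewrite /T1 /perform /heads /=; case: (T s').
have [n [T' [st' [n_le run T'_st' Qst']]]] := reach T1 T1_st.
exists n.+1, T', st'; split=> //.
by rewrite iterSr (code_step_at _ b_branch) /= (tapes_hold_head _ T_st).
Qed.

Definition jump (l : nat) : instr := Branch input xpred0 l.

Lemma reaches_jump code b l r st B b' Q :
  code_at code b (jump l :: r) -> reaches code l st B b' Q ->
  reaches code b st B.+1 b' Q.
Proof. by move=> b_jump reach; exact: (reaches_branch b_jump). Qed.

Inductive prog :=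
| Skip
| Push of name & cell
| Pop of name
| Transfer of name & name
| Seq of prog & prog
| IfTop of name & pred (option cell) & prog & prog
| While of name & prog.

Fixpoint code_size (p : prog) : nat :=
  match p with
  | Skip => 0
  | Pop _ => 1
  | Push _ _ | Transfer _ _ => 2
  | Seq p q => code_size p + code_size q
  | IfTop _ _ p q => (code_size p + code_size q).+2
  | While _ p => (code_size p).+2
  end.

Fixpoint compile (p : prog) (b : nat) : seq instr :=
  match p with
  | Skip => [::]
  | Push s x => [:: GoLeft s; Write s x]
  | Pop s => [:: Erase s]
  | Transfer s s' => [:: GoLeft s'; Carry s s']
  | Seq p q => compile p b ++ compile q (b + code_size p)
  | IfTop s f p q =>
      let else_ix := (b.+1 + code_size p).+1 in
      Branch s f else_ix :: compile p b.+1
      ++ jump (else_ix + code_size q) :: compile q else_ix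
  | While s p =>
      Branch s isSome (b + code_size p).+2 :: compile p b.+1 ++ [:: jump b]
  end.

Lemma size_compile p b : size (compile p b) = code_size p.
Proof.
elim: p b => //= [p IHp q IHq|s f p IHp q IHq|s p IHp] b.
- by rewrite size_cat IHp IHq.
- by rewrite size_cat /= IHp IHq addnS.
- by rewrite size_cat /= IHp addn1.
Qed.

Definition runs (p : prog) (st : stacks) (B : nat) (Q : stacks -> Prop) : Prop :=
  forall code b, code_at code b (compile p b) ->
    reaches code b st B (b + code_size p) Q.

Lemma runs_weaken p st B B' (Q Q' : stacks -> Prop) :
  runs p st B Q -> B <= B' -> (forall st', Q st' -> Q' st') -> runs p st B' Q'.
Proof. by move=> run_p B_le QQ' code b /run_p; apply: reaches_weaken. Qed.

Lemma runs_post p st B (Q Q' : stacks -> Prop) :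
  runs p st B Q -> (forall st', Q st' -> Q' st') -> runs p st B Q'.
Proof. by move=> run_p; apply: runs_weaken run_p (leqnn B). Qed.

Lemma runs_skip st B (Q : stacks -> Prop) : Q st -> runs Skip st B Q.
Proof. by move=> Qst code b _; rewrite addn0; apply: reaches_refl. Qed.

Lemma runs_push s x st B (Q : stacks -> Prop) :
  1 < B -> Q (set_stack st s (x :: st s)) -> runs (Push s x) st B Q.
Proof.
move=> B_gt1 Qst code b b_push T T_st.
pose T1 := perform (instr_act (GoLeft s) (heads T)) T.
exists 2, (perform (instr_act (Write s x) (heads T1)) T1), (set_stack st s (x :: st s)).
split=> //.
  by rewrite addn2 /= (code_step_at _ b_push) (code_step_at _ (code_at_tail b_push)).
move=> s'; rewrite /set_stack /perform /T1 /heads /perform /=; case: eqP => [->|_].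
  by have := holds_stack_push x (T_st s); case: (T s).
by have := T_st s'; case: (T s').
Qed.

Lemma runs_pop s st B (Q : stacks -> Prop) :
  0 < B -> Q (set_stack st s (behead (st s))) -> runs (Pop s) st B Q.
Proof.
move=> B_gt0 Qst code b b_pop T T_st.
exists 1, (perform (instr_act (Erase s) (heads T)) T), (set_stack st s (behead (st s))).
split=> //; first by rewrite addn1 /= (code_step_at _ b_pop).
move=> s'; rewrite /set_stack /perform /heads /=; case: eqP => [->|_].
  exact: holds_stack_pop.
by have := T_st s'; case: (T s').
Qed.

Lemma runs_transfer s s' st B (Q : stacks -> Prop) :
  s != s' -> 1 < B ->
  Q (set_stack (set_stack st s (behead (st s))) s' (head (mark false) (st s) :: st s')) ->
  runs (Transfer s s') st B Q.
Proof.
move=> /negbTE ss' B_gt1 Qst code b b_transfer T T_st.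
pose T1 := perform (instr_act (GoLeft s') (heads T)) T.
exists 2, (perform (instr_act (Carry s s') (heads T1)) T1); eexists; split; last exact: Qst.
- by [].
- by rewrite addn2 /= (code_step_at _ b_transfer) (code_step_at _ (code_at_tail b_transfer)).
have head_s : heads T1 s = ohead (st s).
  by rewrite /heads /T1 /perform /= ss' /heads; have /holds_stack_head := T_st s; case: (T s).
move=> t; rewrite /set_stack /perform /= head_s /T1 /heads /perform /=; case: eqP => [->|_].
  rewrite (_ : odflt _ _ = head (mark false) (st s)); last by case: (st s).
  by have := holds_stack_push (head (mark false) (st s)) (T_st s'); case: (T s').
case: eqP => [->|_]; last by have := T_st t; case: (T t).
by have := holds_stack_pop (T_st s); case: (T s).
Qed.

Lemma runs_seq p q st B1 B2 B Q :
  runs p st B1 (fun st' => runs q st' B2 Q) -> B1 + B2 <= B -> runs (Seq p q) st B Q.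
Proof.
move=> run_p B_le code b b_pq; apply: reaches_weaken B_le (fun _ => id) _.
have := code_at_catr b_pq; rewrite size_compile => b_q.
apply: reaches_trans (reaches_weaken (leqnn _) _ (run_p _ _ (code_at_catl b_pq))) => st1 run_q.
by rewrite /= addnA; apply: run_q.
Qed.

Lemma runs_if s (f : pred (option cell)) p q st B Q :
  (if f (ohead (st s)) then runs p st B Q else runs q st B Q) ->
  runs (IfTop s f p q) st B.+2 Q.
Proof.
move=> run_pq code b b_if.
have b_p := code_at_tail b_if; have := code_at_catr b_p; rewrite size_compile => b_else.
have -> : b + code_size (IfTop s f p q) = (b.+1 + code_size p).+1 + code_size q.
  by rewrite /=; lia.
apply: (reaches_branch b_if); case: ifP run_pq => _ run_pq.
  rewrite -[B.+1]addn1; apply: reaches_trans.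
  apply: reaches_weaken (leqnn _) _ (run_pq _ _ (code_at_catl b_p)) => st' Qst'.
  exact: reaches_jump b_else (reaches_refl _ _ _ Qst').
apply: reaches_weaken (leqnSn _) (fun _ => id) _.
exact: run_pq (code_at_tail b_else).
Qed.

Lemma runs_while_exit s p st B (Q : stacks -> Prop) :
  0 < B -> st s = [::] -> Q st -> runs (While s p) st B Q.
Proof.
move=> B_gt0 st_s Qst code b b_while; apply: reaches_weaken B_gt0 (fun _ => id) _.
apply: (reaches_branch b_while); rewrite st_s /= addnS addnS; exact: reaches_refl.
Qed.

Lemma runs_while_enter s p st B1 B2 B Q :
  st s != [::] -> runs p st B1 (fun st' => runs (While s p) st' B2 Q) ->
  B1 + B2 + 2 <= B -> runs (While s p) st B Q.
Proof.
move=> st_s run_p B_le code b b_while; apply: reaches_weaken B_le (fun _ => id) _.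
have b_p := code_at_tail b_while; have := code_at_catr b_p; rewrite size_compile => b_jump.
rewrite addn2 -addnS; apply: (reaches_branch b_while).
have -> : isSome (ohead (st s)) by case: (st s) st_s.
apply: reaches_trans (reaches_weaken (leqnn _) _ (run_p _ _ (code_at_catl b_p))) => st1 run_while.
exact: reaches_jump b_jump (run_while _ _ b_while).
Qed.

Lemma runs_while s p st k B B' (I : nat -> stacks -> Prop) Q :
  I 0 st -> (forall j st', I j st' -> size (st' s) = k - j) ->
  (forall j st', j < k -> I j st' -> runs p st' B (I j.+1)) ->
  (forall st', I k st' -> Q st') -> k * B.+2 < B' -> runs (While s p) st B' Q.
Proof.
move=> I0 size_s body IkQ B'_gt.
suff from_iteration r j st' : j + r = k -> I j st' -> runs (While s p) st' (r * B.+2).+1 (I k).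
  exact: runs_weaken (from_iteration k 0 st (add0n k) I0) B'_gt IkQ.
elim: r j st' => [|r IH] j st' jrk Ij; have := size_s _ _ Ij.
  rewrite -jrk addn0 subnn => /size0nil st'_s.
  by apply: runs_while_exit st'_s _ => //; rewrite addn0.
move=> size_st'; apply: (@runs_while_enter _ _ _ B (r * B.+2).+1); last by rewrite mulSn; lia.
  by rewrite -size_eq0 size_st'; lia.
apply: runs_post (body j st' _ Ij) _ => [|st'']; first lia.
by apply: IH; lia.
Qed.

Definition input_stacks (w : seq S) : stacks :=
  fun s => if s == input then map inl w else [::].

Theorem prog_verdict p (output : name) (verdict : pred (option cell)) w B Q :
  runs p (input_stacks w) B Q ->
  exists2 st, Q st & forall t, B < t ->
    tm_verdict (code_machine (compile p 0) output verdict) w t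
    = Some (verdict (ohead (st output))).
Proof.
move=> run_p; set M := code_machine _ _ _; set code := compile p 0.
pose T s := if s == input then input_tape (map inl w) else blank_tape cell.
have T_w : tapes_hold T (input_stacks w).
  move=> s; rewrite /T /input_stacks; case: eqP => _.
    exact: holds_input_tape.
  exact: holds_blank_tape.
have init : simulates (tm_init M w) (0, T).
  split=> //= s s_in; rewrite ffunE /T; congr (if _ then _ else _).
  apply/eqP/eqP => [s_ix|->]; first by rewrite -(tape_ixK s_in) s_ix.
  by apply/val_inj; rewrite /tape_ix /= eqxx inordK.
have code_p : code_at code 0 (compile p 0) by exists [::], [::]; rewrite cats0.
have [n [T' [st [n_le run_n T'_st Qst]]]] := run_p _ _ code_p T T_w.
exists st => // t t_gt.
have exit : size code <= 0 + code_size p by rewrite size_compile.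
have [n' n'_le sim] := simulates_exit init run_n exit.
rewrite /tm_verdict (_ : t = t - n' + n'); last lia.
by rewrite iterD (simulates_verdict sim) ?(tapes_hold_head _ T'_st) //; lia.
Qed.

Definition unary (k : nat) : seq cell := nseq k (mark true).

Lemma unary_cat k l r : unary k ++ unary l ++ r = unary (k + l) ++ r.
Proof. by rewrite catA -nseqD. Qed.

Lemma catrev_unary k l : catrev (unary k) l = unary k ++ l.
Proof. by rewrite catrevE rev_nseq. Qed.

Definition clear (s : name) : prog := While s (Pop s).

Lemma runs_clear s st B :
  3 * size (st s) < B -> runs (clear s) st B (fun st' => st' =1 set_stack st s [::]).
Proof.
move=> B_gt; pose I j st' := st' =1 set_stack st s (drop j (st s)).
apply: (runs_while (k := size (st s)) (B := 1) (I := I)).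
- by move=> t; rewrite /set_stack drop0; case: eqP => [->|].
- by move=> j st' st'E; rewrite st'E /set_stack eqxx size_drop.
- move=> j st' _ st'E; apply: runs_pop => // t; rewrite /set_stack !st'E /set_stack eqxx.
  by case: eqP => // _; rewrite -drop1 drop_drop add1n.
- by move=> st' st'E t; rewrite st'E drop_size.
- by rewrite mulnC.
Qed.

Definition move_all (s s' : name) : prog := While s (Transfer s s').

Lemma runs_move_all s s' st B :
  s != s' -> 4 * size (st s) < B ->
  runs (move_all s s') st B
    (fun st' => st' =1 set_stack (set_stack st s [::]) s' (catrev (st s) (st s'))).
Proof.
move=> ss' B_gt; pose I j st' := st' =1 set_stack
  (set_stack st s (drop j (st s))) s' (catrev (take j (st s)) (st s')).
apply: (runs_while (k := size (st s)) (B := 2) (I := I)).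
- move=> t; rewrite /set_stack drop0 take0 /=; case: eqP => [->|_] //.
  by case: eqP => [->|].
- by move=> j st' st'E; rewrite st'E /set_stack (negbTE ss') eqxx size_drop.
- move=> j st' j_lt st'E; apply: runs_transfer => // t.
  rewrite /set_stack !st'E /set_stack !eqxx (negbTE ss').
  have [_|_] := eqVneq t s'; last by case: eqP => // _; rewrite -drop1 drop_drop add1n.
  rewrite (take_nth (mark false)) // -nth0 nth_drop addn0.
  by rewrite -cats1 catrev_catl.
- by move=> st' st'E t; rewrite st'E drop_size take_size.
- by rewrite mulnC.
Qed.

Definition copy (tmp s s' : name) : prog :=
  Seq (move_all s tmp) (While tmp (Seq (Transfer tmp s) (Push s' (mark true)))).

Lemma runs_copy tmp s s' st k B :
  uniq [:: tmp; s; s'] -> st s = unary k -> st tmp = [::] -> 10 * k + 1 < B ->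
  runs (copy tmp s s') st B (fun st' => st' =1 set_stack st s' (unary k ++ st s')).
Proof.
rewrite /= !inE negb_or andbT => /andP[/andP[tmp_s tmp_s'] s_s'] st_s st_tmp B_gt.
have s_tmp : s != tmp by rewrite eq_sym.
apply: (runs_seq (B1 := (4 * k).+1) (B2 := (6 * k).+1)); last by lia.
apply: runs_post (runs_move_all s_tmp _) _; first by rewrite st_s size_nseq.
rewrite st_s st_tmp catrev_unary cats0 => st1 st1E.
pose I j st' := st' =1 set_stack (set_stack (set_stack st
  tmp (unary (k - j))) s (unary j)) s' (unary j ++ st s').
apply: (runs_while (k := k) (B := 4) (I := I)); last by lia.
- move=> t; rewrite st1E /set_stack subn0; case: eqVneq => [->|_].
    by rewrite (negbTE tmp_s') (negbTE tmp_s).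
  case: eqVneq => [->|_]; first by rewrite (negbTE s_s').
  by case: eqVneq => [->|].
- move=> j st' st'E; rewrite st'E /set_stack.
  by rewrite (negbTE tmp_s') (negbTE tmp_s) eqxx size_nseq.
- move=> j st' j_lt st'E; apply: (runs_seq (B1 := 2) (B2 := 2)) => //.
  apply: runs_transfer => //; apply: runs_push => // t.
  rewrite /set_stack !st'E /set_stack !eqxx (negbTE tmp_s) (negbTE tmp_s').
  rewrite (negbTE s_s') [s' == s]eq_sym (negbTE s_s') [s' == tmp]eq_sym (negbTE tmp_s').
  have kj : k - j = (k - j.+1).+1 by lia.
  by rewrite kj /=; do 3!case: (t == _).
- move=> st' st'E t; rewrite st'E /set_stack subnn.
  case: eqVneq => // _; case: eqVneq => [->//|_].
  by case: eqVneq => [->|].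
Qed.

Definition countdown (s : name) (p : prog) : prog := While s (Seq (Pop s) p).

Lemma runs_countdown s p st k B B' (I : nat -> stacks -> Prop) Q :
  I 0 st -> (forall j st', I j st' -> st' s = unary (k - j)) ->
  (forall j st', j < k -> I j st' ->
     runs p (set_stack st' s (unary (k - j.+1))) B (I j.+1)) ->
  (forall st', I k st' -> Q st') -> k * (B + 3) < B' -> runs (countdown s p) st B' Q.
Proof.
move=> I0 Is body IkQ B'_gt; apply: (runs_while (k := k) (B := B.+1) (I := I)) => //.
- by move=> j st' /Is ->; rewrite size_nseq.
- move=> j st' j_lt Ij; apply: (runs_seq (B1 := 1) (B2 := B)) => //; apply: runs_pop => //.
  by rewrite (Is _ _ Ij) (_ : k - j = (k - j.+1).+1); [apply: body|lia].
- by rewrite -addn3.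
Qed.

Fixpoint push_marks (k : nat) (s : name) : prog :=
  if k is k'.+1 then Seq (Push s (mark true)) (push_marks k' s) else Skip.

Lemma runs_push_marks k s st B :
  2 * k <= B ->
  runs (push_marks k s) st B (fun st' => st' =1 set_stack st s (unary k ++ st s)).
Proof.
elim: k st B => [|k IH] st B B_ge /=.
  by apply: runs_skip => t; rewrite /set_stack; case: eqP => [->|].
apply: (runs_seq (B1 := 2) (B2 := 2 * k)); last by lia.
apply: runs_push => //; apply: runs_post (IH _ _ (leqnn _)) _ => st' st'E t.
rewrite st'E /set_stack eqxx; case: eqP => // _.
by rewrite -[mark true :: st s]/(unary 1 ++ st s) unary_cat addn1.
Qed.

End StackCode.
Arguments mark {S}.
Arguments unary {S}.
Arguments Skip {S name}.
Arguments Pop {S name}.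
Arguments Transfer {S name}.
Arguments clear {S name}.
Arguments move_all {S name}.
Arguments copy {S name}.
Arguments push_marks {S name}.

(** * Polynomial bounds *)

Definition poly_bounded (f : nat -> nat) : Prop :=
  exists c d, forall n, f n <= c * n ^ d + c.

Lemma poly_boundedP f :
  poly_bounded f <-> exists c d, forall n, f n <= c * n.+1 ^ d.
Proof.
split=> -[c [d f_le]].
  exists (c + c), d => n; apply: leq_trans (f_le n) _.
  have n_le : n ^ d <= n.+1 ^ d by case: (d) => // d'; rewrite leq_exp2r.
  by rewrite mulnDl leq_add ?leq_mul // leq_pmulr ?expn_gt0.
exists (c * 2 ^ d), d => n; apply: leq_trans (f_le n) _.
case: n => [|n]; first by rewrite exp1n muln1 (leq_trans _ (leq_addl _ _)) // leq_pmulr ?expn_gt0.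
apply: leq_trans (leq_addr _ _); rewrite -mulnA leq_mul // -expnMn.
by case: d {f_le} => // d; rewrite leq_exp2r //; lia.
Qed.

Lemma poly_bounded_const k : poly_bounded (fun=> k).
Proof. by exists k, 0 => n; rewrite leq_addl. Qed.

Lemma poly_bounded_id : poly_bounded id.
Proof. by exists 1, 1 => n; rewrite expn1; lia. Qed.

Lemma poly_boundedD f g :
  poly_bounded f -> poly_bounded g -> poly_bounded (fun n => f n + g n).
Proof.
move=> /poly_boundedP[c [d f_le]] /poly_boundedP[c' [d' g_le]].
apply/poly_boundedP; exists (c + c'), (d + d') => n; rewrite mulnDl leq_add //.
  by rewrite (leq_trans (f_le n)) // leq_mul // leq_pexp2l // leq_addr.
by rewrite (leq_trans (g_le n)) // leq_mul // leq_pexp2l // leq_addl.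
Qed.

Lemma poly_boundedM f g :
  poly_bounded f -> poly_bounded g -> poly_bounded (fun n => f n * g n).
Proof.
move=> /poly_boundedP[c [d f_le]] /poly_boundedP[c' [d' g_le]].
apply/poly_boundedP; exists (c * c'), (d + d') => n.
by rewrite expnD mulnACA leq_mul.
Qed.

(** * Array programs *)

Inductive expr :=
| EVar of nat
| ESize
| EConst of nat
| EAdd of expr & expr
| EMul of expr & expr.

Fixpoint eval (N : nat) (v : nat -> nat) (e : expr) : nat :=
  match e with
  | EVar x => v x
  | ESize => N
  | EConst k => k
  | EAdd e1 e2 => eval N v e1 + eval N v e2
  | EMul e1 e2 => eval N v e1 * eval N v e2
  end.

Fixpoint expr_bound (e : expr) (N : nat) : nat :=
  match e with
  | EVar _ | ESize => N
  | EConst k => k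
  | EAdd e1 e2 => expr_bound e1 N + expr_bound e2 N
  | EMul e1 e2 => expr_bound e1 N * expr_bound e2 N
  end.

Lemma eval_bound N v e : (forall x, v x <= N) -> eval N v e <= expr_bound e N.
Proof. by move=> v_le; elim: e => //= *; rewrite ?leq_add ?leq_mul. Qed.

Lemma expr_bound_poly e : poly_bounded (expr_bound e).
Proof.
elim: e => [x||k|e1 IH1 e2 IH2|e1 IH1 e2 IH2].
- exact: poly_bounded_id.
- exact: poly_bounded_id.
- exact: poly_bounded_const.
- exact: poly_boundedD.
- exact: poly_boundedM.
Qed.

Ltac poly_bounded_sum cost_lemma := repeat first
  [ assumption | apply: cost_lemma | apply: expr_bound_poly | apply: poly_bounded_id
  | apply: poly_bounded_const | apply: poly_boundedD | apply: poly_boundedM ].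

Inductive register :=
| Array of nat
| Var of nat
| Counter of nat
| Length
| Scratch
| Index
| Room
| Flag.

Definition register_code (r : register) : nat * nat :=
  match r with
  | Array a => (0, a)
  | Var x => (1, x)
  | Counter d => (2, d)
  | Length => (3, 0)
  | Scratch => (4, 0)
  | Index => (5, 0)
  | Room => (6, 0)
  | Flag => (7, 0)
  end.

Lemma register_code_inj : injective register_code.
Proof. by case=> [a|x|d|||||] [a'|x'|d'|||||] //= [->]. Qed.

HB.instance Definition _ := Equality.copy register (inj_type register_code_inj).

Lemma nth_mkseq_cat (T : Type) (x0 : T) (s t : seq T) k i :
  nth x0 (mkseq (nth x0 s) k ++ t) i = if i < k then nth x0 s i else nth x0 t (i - k).
Proof. by rewrite nth_cat size_mkseq; case: ltnP => // i_lt; rewrite nth_mkseq. Qed.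

Section ArrayPrograms.
Variable S : finType.
Notation cell := (cell S).
Notation stacks := (stacks S register).
Notation prog := (prog S register).
Notation runs := (@runs S register (Array 0)).
Implicit Types (st : stacks) (r : register) (B : nat).

Fixpoint eval_prog (d : nat) (e : expr) (r : register) : prog :=
  match e with
  | EVar x => copy Scratch (Var x) r
  | ESize => copy Scratch Length r
  | EConst k => push_marks k r
  | EAdd e1 e2 => Seq (eval_prog d e1 r) (eval_prog d e2 r)
  | EMul e1 e2 =>
      Seq (eval_prog d.+1 e1 (Counter d)) (countdown (Counter d) (eval_prog d.+1 e2 r))
  end.

Fixpoint expr_cost (e : expr) (N : nat) : nat :=
  match e with
  | EVar _ | ESize => 10 * N + 2
  | EConst k => 2 * k
  | EAdd e1 e2 => expr_cost e1 N + expr_cost e2 N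
  | EMul e1 e2 => expr_cost e1 N + (expr_bound e1 N * (expr_cost e2 N + 3) + 1)
  end.

Definition eval_reads (d : nat) (r : register) : bool :=
  match r with
  | Var _ | Length | Scratch => true
  | Counter i => d <= i
  | _ => false
  end.

Definition eval_ready (d N : nat) (v : nat -> nat) (st : stacks) : Prop :=
  [/\ forall x, st (Var x) = unary (v x), st Length = unary N, st Scratch = [::] &
      forall i, d <= i -> st (Counter i) = [::]].

Lemma eq_eval_ready d N v st st' :
  {in eval_reads d, st' =1 st} -> eval_ready d N v st -> eval_ready d N v st'.
Proof.
by move=> st'E [stV stL stS stC]; split=> [x|||i di]; rewrite st'E ?stV ?stL ?stS ?stC.
Qed.

Lemma eval_ready_set d N v st r l :
  ~~ eval_reads d r -> eval_ready d N v st -> eval_ready d N v (set_stack st r l).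
Proof.
move=> r_free; apply: eq_eval_ready => t t_read; rewrite /set_stack.
by case: eqP t_read => // ->; rewrite [_ \in _](negbTE r_free).
Qed.

Lemma eval_readyS d N v st : eval_ready d N v st -> eval_ready d.+1 N v st.
Proof. by move=> [stV stL stS stC]; split=> // i /ltnW; apply: stC. Qed.

Lemma eval_readsS d r : ~~ eval_reads d r -> ~~ eval_reads d.+1 r.
Proof. by case: r => //= i; apply/contra/ltnW. Qed.

Lemma runs_eval d e r v N st B :
  (forall x, v x <= N) -> eval_ready d N v st -> ~~ eval_reads d r ->
  expr_cost e N <= B ->
  runs (eval_prog d e r) st B
    (fun st' => st' =1 set_stack st r (unary (eval N v e) ++ st r)).
Proof.
move=> v_le; elim: e d r st B => [x||k|e1 IH1 e2 IH2|e1 IH1 e2 IH2] d r st B ready r_free B_ge /=.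
- have [stV _ stS _] := ready; apply: runs_copy => //.
    by case: (r) r_free.
  by move: B_ge (v_le x) => /=; lia.
- have [_ stL stS _] := ready; apply: runs_copy => //.
    by case: (r) r_free.
  by move: B_ge => /=; lia.
- exact: runs_push_marks.
- apply: runs_seq B_ge; apply: runs_post (IH1 _ _ _ _ ready r_free (leqnn _)) _ => st1 st1E.
  apply: runs_post (IH2 _ _ _ _ _ r_free (leqnn _)) _.
    apply: eq_eval_ready (eval_ready_set _ r_free ready) => t _; exact: st1E.
  move=> st2 st2E t; rewrite st2E /set_stack !st1E /set_stack eqxx.
  by case: eqP => // _; rewrite unary_cat addnC.
have [_ _ _ /(_ _ (leqnn d)) st_counter] := ready.
have counter_free : ~~ eval_reads d.+1 (Counter d) by rewrite /= ltnn.
have counter_r : (Counter d == r) = false.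
  by apply: contraNF r_free => /eqP<-; rewrite /= leqnn.
apply: runs_seq B_ge.
apply: runs_post (IH1 _ _ _ _ (eval_readyS ready) counter_free (leqnn _)) _ => st1.
rewrite st_counter cats0; set k1 := eval N v e1; set k2 := eval N v e2 => st1E.
pose I j st' := st' =1 set_stack (set_stack st
  (Counter d) (unary (k1 - j))) r (unary (j * k2) ++ st r).
apply: (runs_countdown (k := k1) (B := expr_cost e2 N) (I := I)).
- move=> t; rewrite st1E /set_stack subn0.
  by case: eqP => [->|_]; [rewrite counter_r|case: eqP => [->|]].
- by move=> j st' st'E; rewrite st'E /set_stack counter_r eqxx.
- move=> j st' j_lt st'E.
  apply: runs_post (IH2 _ _ _ _ _ (eval_readsS r_free) (leqnn _)) _.
    apply: eval_ready_set => //; apply: eq_eval_ready (eval_readyS ready) => t t_read.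
    rewrite st'E /set_stack; case: eqP => [t_r|_].
      by rewrite t_r [_ \in _](negbTE (eval_readsS r_free)) in t_read.
    by case: eqP t_read => // ->; rewrite [_ \in _](negbTE counter_free).
  move=> st'' st''E t; rewrite st''E /set_stack !st'E /set_stack eqxx [r == _]eq_sym counter_r.
  by rewrite unary_cat -mulSn; do 2!case: (t == _).
- move=> st' st'E t; rewrite st'E subnn /set_stack.
  by case: eqP => // _; case: eqP => [->|].
- by rewrite addn1 ltnS leq_mul // eval_bound.
Qed.

Definition seek (d a : nat) (e : expr) : prog :=
  Seq (eval_prog d e Index) (countdown Index (Transfer (Array a) Scratch)).

Definition seek_cost (e : expr) (N : nat) : nat := expr_cost e N + (5 * expr_bound e N + 1).

Definition seek_stacks (st : stacks) (a k : nat) : stacks :=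
  set_stack (set_stack st (Array a) (drop k (st (Array a))))
    Scratch (rev (mkseq (nth (mark false) (st (Array a))) k)).

Lemma runs_seek d a e v N st B :
  (forall x, v x <= N) -> eval_ready d N v st -> st Index = [::] -> seek_cost e N <= B ->
  runs (seek d a e) st B (fun st' => st' =1 seek_stacks st a (eval N v e)).
Proof.
move=> v_le ready st_index B_ge; apply: runs_seq B_ge.
apply: runs_post (runs_eval (r := Index) v_le ready _ (leqnn _)) _ => // st1.
rewrite st_index cats0; have [_ _ st_scratch _] := ready.
have := eval_bound e v_le; set k := eval N v e => k_le st1E.
pose I j st' := st' =1 set_stack (seek_stacks st a j) Index (unary (k - j)).
apply: (runs_countdown (k := k) (B := 2) (I := I)); last by lia.
- move=> t; rewrite st1E /seek_stacks /set_stack subn0 drop0.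
  by case: t => //= b; case: eqP => [[->]|].
- by move=> j st' st'E; rewrite st'E.
- move=> j st' j_lt st'E; apply: runs_transfer => // t.
  rewrite /set_stack /= !st'E /seek_stacks /set_stack /= eqxx.
  have [->|_] := eqVneq t Scratch.
    by rewrite mkseqS rev_rcons -nth0 nth_drop addn0.
  have [->|_] := eqVneq t (Array a); first by rewrite -drop1 drop_drop add1n.
  by case: eqP.
- move=> st' st'E t; rewrite st'E subnn /set_stack; case: eqP => [->|] //.
Qed.

Inductive cmd :=
| CSkip
| CSeq of cmd & cmd
| CSet of nat & expr
| CWrite of nat & expr & cell
| CIf of nat & expr & cell & cmd & cmd
| CRepeat of expr & cmd.

Record memory := Mem { vars : nat -> nat; arrs : nat -> nat -> cell }.
Implicit Type m : memory.

Definition set_var m (x k : nat) : memory :=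
  Mem (fun y => if y == x then k else vars m y) (arrs m).

Definition set_cell (A : nat -> nat -> cell) (a i : nat) (x : cell) : nat -> nat -> cell :=
  fun b j => if (b == a) && (j == i) then x else A b j.

Definition set_arr m (a i : nat) (x : cell) : memory :=
  Mem (vars m) (set_cell (arrs m) a i x).

(* Assignments saturate at the input length [N]: this keeps all variables
   bounded by [N], whence the running time of any command is polynomial. *)
Fixpoint exec (N : nat) (c : cmd) m : memory :=
  match c with
  | CSkip => m
  | CSeq c1 c2 => exec N c2 (exec N c1 m)
  | CSet x e => set_var m x (minn (eval N (vars m) e) N)
  | CWrite a e x => set_arr m a (eval N (vars m) e) x
  | CIf a e x c1 c2 =>
      if arrs m a (eval N (vars m) e) == x then exec N c1 m else exec N c2 m
  | CRepeat e c => iter (eval N (vars m) e) (exec N c) m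
  end.

Lemma vars_exec_le N c m :
  (forall x, vars m x <= N) -> forall x, vars (exec N c m) x <= N.
Proof.
elim: c m => //= [c1 IH1 c2 IH2|x e|a e x c1 IH1 c2 IH2|e c IH] m v_le.
- exact/IH2/IH1.
- by move=> y; case: eqP => // _; apply: geq_minr.
- by case: eqP => _; [apply: IH1|apply: IH2].
- by elim: (eval _ _ _) => //= k; apply: IH.
Qed.

Definition move_capped (x : nat) : prog :=
  countdown Index
    (IfTop Room isSome (Seq (Pop Room) (Push (Var x) (mark true))) Skip).

Definition test (d a : nat) (e : expr) (x : cell) : prog :=
  Seq (seek d a e)
 (Seq (IfTop (Array a) (fun o => odflt (mark false) o == x) (Push Flag (mark true)) Skip)
      (move_all Scratch (Array a))).

Fixpoint cmd_prog (d : nat) (c : cmd) : prog :=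
  match c with
  | CSkip => Skip
  | CSeq c1 c2 => Seq (cmd_prog d c1) (cmd_prog d c2)
  | CSet x e =>
      Seq (eval_prog d e Index)
     (Seq (copy Scratch Length Room)
     (Seq (clear (Var x)) (Seq (move_capped x) (clear Room))))
  | CWrite a e x =>
      Seq (seek d a e)
     (Seq (Pop (Array a)) (Seq (Push (Array a) x) (move_all Scratch (Array a))))
  | CIf a e x c1 c2 =>
      Seq (test d a e x)
          (IfTop Flag isSome (Seq (Pop Flag) (cmd_prog d c1)) (cmd_prog d c2))
  | CRepeat e c =>
      Seq (eval_prog d.+1 e (Counter d)) (countdown (Counter d) (cmd_prog d.+1 c))
  end.

Fixpoint cmd_cost (c : cmd) (N : nat) : nat :=
  match c with
  | CSkip => 0
  | CSeq c1 c2 => cmd_cost c1 N + cmd_cost c2 N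
  | CSet x e => expr_cost e N + (16 * N + 8 * expr_bound e N + 5)
  | CWrite a e x => seek_cost e N + (4 * expr_bound e N + 4)
  | CIf a e x c1 c2 =>
      seek_cost e N + (4 * expr_bound e N + 5) + (cmd_cost c1 N + cmd_cost c2 N + 3)
  | CRepeat e c => expr_cost e N + (expr_bound e N * (cmd_cost c N + 3) + 1)
  end.

(* [ks] lists the remaining iterations of the enclosing loops, outermost first. *)
Definition mem_rep (N : nat) (ks : seq nat) m st : Prop :=
  forall r, match r with
  | Array a => nth (mark false) (st r) =1 arrs m a
  | Var x => st r = unary (vars m x)
  | Counter i => st r = unary (nth 0 ks i)
  | Length => st r = unary N
  | Scratch | Index | Room | Flag => st r = [::]
  end.

Lemma eq_mem_rep N ks m st st' : st' =1 st -> mem_rep N ks m st -> mem_rep N ks m st'.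
Proof. by move=> st'E rep r; have := rep r; case: r => *; rewrite ?st'E. Qed.

Lemma mem_rep_ready N ks m st : mem_rep N ks m st -> eval_ready (size ks) N (vars m) st.
Proof.
move=> rep; split=> [x|||i i_ge]; [exact: rep (Var x)|exact: rep Length|exact: rep Scratch|].
by rewrite (rep (Counter i)) nth_default.
Qed.

Lemma mem_rep_rcons N ks k m st :
  mem_rep N (rcons ks k) m st <->
  st (Counter (size ks)) = unary k /\ mem_rep N ks m (set_stack st (Counter (size ks)) [::]).
Proof.
have nthE i : nth 0 (rcons ks k) i = if i == size ks then k else nth 0 ks i.
  by rewrite nth_rcons; case: ltngtP => // i_gt; rewrite nth_default // ltnW.
have counterE i : (Counter i == Counter (size ks)) = (i == size ks) by [].
split=> [rep|[st_counter rep] r].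
  split=> [|r]; first by rewrite (rep (Counter _)) nthE eqxx.
  have := rep r; rewrite /set_stack; case: r => // i; rewrite counterE nthE.
  by case: eqP => // -> _; rewrite nth_default.
have := rep r; rewrite /set_stack; case: r => // i; rewrite counterE nthE.
by case: eqP => // ->.
Qed.

Lemma runs_move_capped x k N st B :
  st Index = unary k -> st Room = unary N -> st (Var x) = [::] -> 8 * k < B ->
  runs (move_capped x) st B (fun st' => st' =1 set_stack (set_stack (set_stack st
    Index [::]) Room (unary (N - k))) (Var x) (unary (minn k N))).
Proof.
move=> st_index st_room st_x B_gt; pose I j st' := st' =1 set_stack (set_stack (set_stack st
  Index (unary (k - j))) Room (unary (N - j))) (Var x) (unary (minn j N)).
apply: (runs_countdown (k := k) (B := 5) (I := I)).
- move=> t; rewrite /set_stack !subn0 min0n; case: eqP => [->//|_].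
  by do 2!case: eqP => [->//|_].
- by move=> j st' st'E; rewrite st'E.
- move=> j st' j_lt st'E; apply: runs_if; rewrite [ohead _]/= /set_stack /= st'E /set_stack /=.
  have [N_le|N_gt] := leqP N j.
    have [N_j N_j1] : N - j = 0 /\ N - j.+1 = 0 by lia.
    have min_j : minn j.+1 N = minn j N by lia.
    rewrite N_j; apply: runs_skip => t; rewrite /set_stack !st'E /set_stack N_j N_j1 min_j.
    by case: t => //= y; case: eqP.
  have N_j : N - j = (N - j.+1).+1 by lia.
  have min_j : minn j.+1 N = (minn j N).+1 by lia.
  rewrite N_j /=; apply: (runs_seq (B1 := 1) (B2 := 2)) => //.
  apply: runs_pop => //; apply: runs_push => // t.
  rewrite /set_stack /= !st'E /set_stack /= eqxx N_j min_j.
  by case: t => //= y; case: eqP.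
- by move=> st' st'E t; rewrite st'E subnn.
- by lia.
Qed.

Lemma runs_set N ks x e m st :
  (forall y, vars m y <= N) -> mem_rep N ks m st ->
  runs (cmd_prog (size ks) (CSet x e)) st (cmd_cost (CSet x e) N)
    (mem_rep N ks (exec N (CSet x e) m)).
Proof.
move=> v_le rep; have ready := mem_rep_ready rep.
have := eval_bound e v_le; set k := eval N (vars m) e => k_le.
apply: runs_seq (leqnn _).
apply: runs_post (runs_eval (r := Index) v_le ready _ (leqnn _)) _ => // st1.
rewrite (rep Index) cats0 -/k => st1E.
apply: (runs_seq (B1 := 10 * N + 2) (B2 := 6 * N + 8 * expr_bound e N + 3)); last by lia.
have st1_length : st1 Length = unary N by rewrite st1E; apply: rep Length.
have st1_scratch : st1 Scratch = [::] by rewrite st1E; apply: rep Scratch.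
have st1_room : st1 Room = [::] by rewrite st1E; apply: rep Room.
apply: runs_post (runs_copy (s' := Room) _ st1_length st1_scratch _) _ => //.
  by lia.
move=> st2; rewrite st1_room cats0 => st2E.
apply: (runs_seq (B1 := 3 * N + 1) (B2 := 3 * N + 8 * expr_bound e N + 2)); last by lia.
apply: runs_post (runs_clear _) _ => [|st3 st3E].
  rewrite st2E /set_stack /= st1E /set_stack /= (rep (Var x)) size_nseq.
  by have := v_le x; lia.
apply: (runs_seq (B1 := 8 * expr_bound e N + 1) (B2 := 3 * N + 1)); last by lia.
have st3_index : st3 Index = unary k by rewrite st3E /set_stack /= st2E /set_stack /= st1E.
have st3_room : st3 Room = unary N by rewrite st3E /set_stack /= st2E.
apply: runs_post (runs_move_capped st3_index st3_room _ _) _.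
- by rewrite st3E /set_stack eqxx.
- by lia.
move=> st4 st4E; apply: runs_post (runs_clear _) _ => [|st5 st5E].
  by rewrite st4E /set_stack /= size_nseq; lia.
move=> r; have := rep r; rewrite st5E /set_stack st4E /set_stack st3E /set_stack st2E /set_stack.
rewrite st1E /set_stack; case: r => //= y.
by rewrite -[Var y == Var x]/(y == x); case: eqP.
Qed.

Lemma runs_write N ks a e x m st :
  (forall y, vars m y <= N) -> mem_rep N ks m st ->
  runs (cmd_prog (size ks) (CWrite a e x)) st (cmd_cost (CWrite a e x) N)
    (mem_rep N ks (exec N (CWrite a e x) m)).
Proof.
move=> v_le rep; have ready := mem_rep_ready rep.
have := eval_bound e v_le => /=; set k := eval N (vars m) e => k_le.
apply: runs_seq (leqnn _).
apply: runs_post (runs_seek v_le ready (rep Index) (leqnn _)) _ => st1 st1E.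
apply: (runs_seq (B1 := 1) (B2 := 4 * expr_bound e N + 3)); last by lia.
apply: runs_pop => //.
apply: (runs_seq (B1 := 2) (B2 := 4 * expr_bound e N + 1)); last by lia.
apply: runs_push => //; apply: runs_post (runs_move_all _ _) _ => //.
  by rewrite /set_stack /= st1E /seek_stacks /set_stack /= size_rev size_mkseq -/k; lia.
move=> st2 st2E r; have := rep r; rewrite st2E /set_stack !st1E /seek_stacks /set_stack /= !eqxx.
rewrite catrevE revK -/k; case: r => //= b.
rewrite -[Array b == Array a]/(b == a) /set_cell; have [->|_] //= := eqVneq b a.
move=> a_rep i; rewrite nth_mkseq_cat.
case: (ltngtP i k) => [i_lt|i_gt|->]; rewrite ?subnn //=.
have -> : i - k = (i - k.+1).+1 by lia.
by rewrite /= -drop1 drop_drop nth_drop -a_rep; congr nth; lia.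
Qed.

Lemma runs_test N ks a e x m st :
  (forall y, vars m y <= N) -> mem_rep N ks m st ->
  runs (test (size ks) a e x) st (seek_cost e N + (4 * expr_bound e N + 5))
    (fun st' => st' Flag = unary (arrs m a (eval N (vars m) e) == x) /\
                mem_rep N ks m (set_stack st' Flag [::])).
Proof.
move=> v_le rep; have ready := mem_rep_ready rep.
have := eval_bound e v_le => /=; set k := eval N (vars m) e => k_le.
apply: runs_seq (leqnn _).
apply: runs_post (runs_seek v_le ready (rep Index) (leqnn _)) _ => st1.
rewrite -/k => st1E.
have head_a : odflt (mark false) (ohead (st1 (Array a))) = arrs m a k.
  rewrite st1E /seek_stacks /set_stack /= eqxx -(rep (Array a)) -[k in RHS]addn0 -nth_drop nth0.
  by case: (drop _ _).
pose set_flag st' := st' =1 set_stack st1 Flag (unary (arrs m a k == x)).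
have st1_flag : st1 Flag = [::] by rewrite st1E; apply: rep Flag.
apply: (runs_seq (B1 := 4) (B2 := 4 * expr_bound e N + 1)); last by lia.
suff run_if : runs (IfTop (Array a) (fun o => odflt (mark false) o == x)
    (Push Flag (mark true)) Skip) st1 4 set_flag.
  apply: runs_post run_if _ => st2 st2E.
  apply: runs_post (runs_move_all _ _) _ => //.
    by rewrite st2E /set_stack /= st1E /seek_stacks /set_stack /= size_rev size_mkseq; lia.
  move=> st3 st3E; split; first by rewrite st3E /set_stack /= st2E.
  move=> r; have := rep r; rewrite /set_stack st3E /set_stack !st2E /set_stack !st1E.
  rewrite /seek_stacks /set_stack /= !eqxx catrevE revK; case: r => //= b.
  rewrite -[Array b == Array a]/(b == a); have [->|_] //= := eqVneq b a.
  move=> a_rep i; rewrite nth_mkseq_cat; case: ltnP => // k_le_i.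
  by rewrite nth_drop subnKC.
apply: runs_if; rewrite head_a /set_flag; case: eqP => _.
  by apply: runs_push => //; rewrite st1_flag.
by apply: runs_skip => t; rewrite /set_stack; case: eqP => [->|].
Qed.

Lemma runs_repeat N ks e c m st :
  (forall ks m st, (forall y, vars m y <= N) -> mem_rep N ks m st ->
     runs (cmd_prog (size ks) c) st (cmd_cost c N) (mem_rep N ks (exec N c m))) ->
  (forall y, vars m y <= N) -> mem_rep N ks m st ->
  runs (cmd_prog (size ks) (CRepeat e c)) st (cmd_cost (CRepeat e c) N)
    (mem_rep N ks (exec N (CRepeat e c) m)).
Proof.
move=> run_c v_le rep; have ready := eval_readyS (mem_rep_ready rep).
have /= := eval_bound e v_le; set k := eval N (vars m) e => k_le.
set counter := Counter (size ks).
have counter_free : ~~ eval_reads (size ks).+1 counter by rewrite /= ltnn.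
have st_counter : st counter = [::] by rewrite (rep counter) nth_default.
have v_le_iter j y : vars (iter j (exec N c) m) y <= N.
  by elim: j y => //= j IH; apply: vars_exec_le.
apply: runs_seq (leqnn _).
apply: runs_post (runs_eval v_le ready counter_free (leqnn _)) _ => st1.
rewrite st_counter cats0 -/k => st1E.
pose I j st' := mem_rep N (rcons ks (k - j)) (iter j (exec N c) m) st'.
apply: (runs_countdown (k := k) (B := cmd_cost c N) (I := I)).
- rewrite /I subn0; apply/mem_rep_rcons; rewrite st1E /set_stack eqxx; split=> //.
  by apply: eq_mem_rep rep => r; rewrite st1E /set_stack; case: eqP => [->|].
- by move=> j st' /mem_rep_rcons[].
- move=> j st' j_lt /mem_rep_rcons[_ rep'].
  have := run_c (rcons ks (k - j.+1)) _ (set_stack st' counter (unary (k - j.+1))) (v_le_iter j).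
  rewrite size_rcons; apply; apply/mem_rep_rcons; rewrite /set_stack eqxx; split=> //.
  by apply: eq_mem_rep rep' => r; rewrite /set_stack; case: eqP.
- move=> st'; rewrite /I subnn => /mem_rep_rcons[st'_counter].
  by apply: eq_mem_rep => r; rewrite /set_stack; case: eqP => [->|].
- by rewrite addn1 ltnS leq_mul.
Qed.

Lemma runs_cmd c ks N m st :
  (forall x, vars m x <= N) -> mem_rep N ks m st ->
  runs (cmd_prog (size ks) c) st (cmd_cost c N) (mem_rep N ks (exec N c m)).
Proof.
elim: c ks m st => [|c1 IH1 c2 IH2|x e|a e x|a e x c1 IH1 c2 IH2|e c IH] ks m st v_le rep.
- exact: runs_skip.
- apply: runs_seq (leqnn _); apply: runs_post (IH1 _ _ _ v_le rep) _ => st1 rep1.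
  by apply: IH2 rep1; apply: vars_exec_le.
- exact: runs_set.
- exact: runs_write.
- apply: (runs_seq (B2 := cmd_cost c1 N + cmd_cost c2 N + 3)) (leqnn _).
  apply: runs_post (runs_test v_le rep) _ => st1 [st1_flag rep1].
  rewrite addn3 [exec N _ m]/=; apply: runs_if; rewrite st1_flag.
  case: (arrs m a _ == x) st1_flag => st1_flag; rewrite [isSome _]/=.
    apply: (runs_seq (B1 := 1) (B2 := cmd_cost c1 N)); last by lia.
    by apply: runs_pop => //; rewrite st1_flag; apply: IH1.
  apply: runs_weaken (IH2 _ _ _ v_le _) _ (fun _ => id); last by lia.
  by apply: eq_mem_rep rep1 => r; rewrite /set_stack; case: eqP => [->|].
- exact: runs_repeat.
Qed.

Lemma expr_cost_poly e : poly_bounded (expr_cost e).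
Proof. by elim: e => [x||k|e1 IH1 e2 IH2|e1 IH1 e2 IH2]; poly_bounded_sum expr_bound_poly. Qed.

Lemma cmd_cost_poly c : poly_bounded (cmd_cost c).
Proof.
rewrite /cmd_cost /seek_cost.
by elim: c => [|c1 IH1 c2 IH2|x e|a e x|a e x c1 IH1 c2 IH2|e c IH];
  poly_bounded_sum expr_cost_poly.
Qed.

Definition size_prog : prog :=
  Seq (While (Array 0)
         (Seq (Transfer (Array 0) Scratch) (Push Length (mark true))))
      (move_all Scratch (Array 0)).

Definition init_mem (w : seq S) : memory :=
  Mem (fun=> 0)
      (fun a i => if a == 0 then nth (mark false) (map inl w) i else mark false).

Lemma runs_size w :
  runs size_prog (input_stacks (Array 0) w) (10 * size w + 2)
    (mem_rep (size w) [::] (init_mem w)).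
Proof.
set st := input_stacks _ w; set l : seq cell := map inl w.
apply: (runs_seq (B1 := 6 * size w + 1) (B2 := 4 * size w + 1)); last by lia.
pose I j st' := st' =1 set_stack (set_stack (set_stack st
  (Array 0) (drop j l)) Scratch (rev (take j l))) Length (unary j).
have size_l : size l = size w by rewrite size_map.
apply: (runs_while (k := size w) (B := 4) (I := I)); last by lia.
- by move=> t; rewrite /set_stack drop0 take0 /st /input_stacks; case: t => //= a; case: eqP.
- by move=> j st' st'E; rewrite st'E /set_stack /= size_drop size_l.
- move=> j st' j_lt st'E; apply: (runs_seq (B1 := 2) (B2 := 2)) => //.
  apply: runs_transfer => //; apply: runs_push => // t.
  rewrite /set_stack /= !st'E /set_stack /= (take_nth (mark false)) ?size_l // rev_rcons.
  by rewrite -nth0 nth_drop addn0 -drop1 drop_drop add1n; case: t => //= a; case: eqP.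
move=> st1; rewrite /I -size_l drop_size take_size => st1E.
apply: runs_post (runs_move_all _ _) _ => //.
  by rewrite st1E /set_stack /= size_rev; lia.
move=> st2 st2E r; rewrite st2E /set_stack !st1E /set_stack /=.
rewrite catrevE revK cats0 /st /input_stacks.
case: r => //= a; last by rewrite nth_nil.
rewrite -[Array a == Array 0]/(a == 0).
by case: eqP => // _ i; rewrite nth_nil.
Qed.

End ArrayPrograms.
Arguments CSkip {S}.
Arguments CSet {S}.

Theorem cmd_polytime (P : decision_problem) (c : cmd (alphabet P)) (a : nat) :
  (forall x : instance P,
     arrs (exec (size (encode x)) c (init_mem (encode x))) a 0 != mark true
     <-> yes_instance x) ->
  polytime_solvable P.
Proof.
move=> c_correct; pose p := Seq (size_prog (alphabet P)) (cmd_prog 0 c).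
pose verdict (o : option (cell (alphabet P))) := odflt (mark false) o != mark true.
have [k [d bound]] : poly_bounded (fun N => 10 * N + 2 + cmd_cost c N + 1).
  by poly_bounded_sum (cmd_cost_poly c).
exists (code_machine (Array 0) (compile (Array 0) p 0) (Array a) verdict), k, d => x.
have := c_correct x; set w := encode x => yes_iff.
have run_p : runs (Array 0) p (input_stacks (Array 0) w) (10 * size w + 2 + cmd_cost c (size w))
    (mem_rep (size w) [::] (exec (size w) c (init_mem w))).
  apply: runs_seq (leqnn _); apply: runs_post (@runs_size _ w) _ => st rep.
  exact: (@runs_cmd _ c [::]).
have [st rep verdictE] := prog_verdict (Array a) verdict run_p.
exists (verdict (ohead (st (Array a)))); first by apply: verdictE; have := bound (size w); lia.
rewrite -yes_iff -(rep (Array a)) /verdict.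
by case: (st (Array a)).
Qed.

(** * Consecutive orderings *)

Section ForcedPairs.
Variables (U J : Type) (X : J -> pred U).
Implicit Types (D : U -> U -> Prop) (x y z w : U) (j : J).

Definition separates j x z y : bool := [&& X j x, X j z & ~~ X j y].

Definition forcing_closed D : Prop :=
  forall j x y z, separates j x z y -> (D x y <-> D z y) /\ (D y x <-> D y z).

Definition converse D x y : Prop := D y x.

Lemma separatesI j x y z : X j x -> X j z -> ~~ X j y -> separates j x z y.
Proof. by move=> xj zj yj; apply/and3P. Qed.

Lemma separatesC j x z y : separates j x z y = separates j z x y.
Proof. exact: andbCA. Qed.

Lemma forcing_closed_converse D : forcing_closed D -> forcing_closed (converse D).
Proof. by move=> D_closed j x y z /D_closed[]. Qed.

Lemma forcing_closedI D :
  (forall j x y z, separates j x z y -> (D x y -> D z y) /\ (D y x -> D y z)) ->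
  forcing_closed D.
Proof.
move=> D_closed j x y z sep; have [xz_y y_xz] := D_closed _ _ _ _ sep.
by rewrite separatesC in sep; have [zx_y y_zx] := D_closed _ _ _ _ sep.
Qed.

Lemma key_forcing_closed (k : U -> nat) :
  (forall j x y z, X j x -> X j z -> k x <= k y <= k z -> X j y) ->
  forcing_closed (fun x y => k x < k y).
Proof.
move=> consecutive; apply: forcing_closedI => j x y z /and3P[xj zj yj].
split=> lt_key; rewrite ltnNge; apply: contra yj => le_key.
  by apply: consecutive xj zj _; rewrite ltnW.
by apply: consecutive zj xj _; rewrite le_key ltnW.
Qed.

Lemma forcing_closed_between D j x y z :
  forcing_closed D -> (forall u, ~ D u u) -> (forall u v w, D u v -> D v w -> D u w) ->
  X j x -> X j z -> D x y -> D y z -> X j y.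
Proof.
move=> D_closed D_irr D_trans xj zj Dxy Dyz; apply: contraT => yj.
have [xz_y _] := D_closed j x y z (separatesI xj zj yj).
by case: (D_irr y); apply: D_trans Dyz _; apply/xz_y.
Qed.

(* In a linear order for which all sets are intervals, [x < y] holds for all
   pairs forced by [(a, b)] or for none. *)
Inductive forced a b : U -> U -> Prop :=
| forced_refl : forced a b a b
| forced_left j x y z : separates j x z y -> forced a b x y -> forced a b z y
| forced_right j x y z : separates j x z y -> forced a b y x -> forced a b y z.

Lemma forced_closed a b : forcing_closed (forced a b).
Proof.
by apply: forcing_closedI => j x y z sep; split;
  [apply: forced_left sep|apply: forced_right sep].
Qed.

Lemma forced_converse a b x y : forced a b x y -> forced b a y x.
Proof.
elim=> [|j {}x {}y z sep _|j {}x {}y z sep _]; first exact: forced_refl.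
  exact: forced_right sep.
exact: forced_left sep.
Qed.

Lemma forced_iff D a b x y : forcing_closed D -> forced a b x y -> (D x y <-> D a b).
Proof.
move=> D_closed; elim=> // j {}x {}y z /D_closed[xz_y y_xz] _ <-.
  exact: iff_sym.
exact: iff_sym.
Qed.

Lemma forced_asym D a b x y :
  forcing_closed D -> (forall u v, D u v -> ~ D v u) -> D a b \/ D b a ->
  forced a b x y -> ~ forced a b y x.
Proof.
move=> D_closed D_asym D_ab Cxy Cyx; have D'_closed := forcing_closed_converse D_closed.
case: D_ab => [Dab|Dba].
  by apply: (D_asym x y); [apply/(forced_iff D_closed Cxy)|apply/(forced_iff D_closed Cyx)].
by apply: (D_asym y x); [apply/(forced_iff D'_closed Cxy)|apply/(forced_iff D'_closed Cyx)].
Qed.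

Definition weak D x y : Prop := x = y \/ D x y.

Definition extension D a b x y : Prop :=
  D x y \/ exists u v, [/\ weak D x u, forced a b u v & weak D v y].

Lemma extension_pair D a b : extension D a b a b.
Proof. by right; exists a, b; split; [left|apply: forced_refl|left]. Qed.

Lemma extension_converse D a b x y :
  extension D a b x y -> extension (converse D) b a y x.
Proof.
have weakC u v : weak D u v -> weak (converse D) v u by case=> [->|]; [left|right].
case=> [|[u [v [/weakC xu /forced_converse Cuv /weakC vy]]]]; first by left.
by right; exists v, u.
Qed.

Lemma extension_forcing_left D a b j x y z :
  forcing_closed D -> separates j x z y -> extension D a b x y -> extension D a b z y.
Proof.
move=> D_closed /and3P[xj zj yj].
have from_set u v : X j u -> forced a b u v -> weak D v y -> extension D a b z y.
  move=> uj Cuv vy; have [vj|vj] := boolP (X j v).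
    case: vy => [vE|Dvy]; first by rewrite -vE vj in yj.
    have [vz _] := D_closed j v y z (separatesI vj zj yj).
    by left; apply/vz.
  right; exists z, v; split=> //; first by left.
  by apply: (@forced_left a b j u) => //; apply: separatesI.
case=> [Dxy|[u [v [xu Cuv vy]]]].
  have [xz _] := D_closed j x y z (separatesI xj zj yj).
  by left; apply/xz.
case: xu => [xE|Dxu]; first by apply: (from_set u v) => //; rewrite -xE.
have [uj|uj] := boolP (X j u); first exact: (from_set u v).
have [xz _] := D_closed j x u z (separatesI xj zj uj).
by right; exists u, v; split=> //; right; apply/xz.
Qed.

Lemma extension_forcing D a b : forcing_closed D -> forcing_closed (extension D a b).
Proof.
move=> D_closed; apply: forcing_closedI => j x y z sep; split.
  exact: extension_forcing_left sep.
move=> /extension_converse ext; apply: (@extension_converse (converse D) b a).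
exact: extension_forcing_left (forcing_closed_converse D_closed) sep ext.
Qed.

Section Order.
Variables (D : U -> U -> Prop) (a b : U).
Hypotheses (D_irr : forall x, ~ D x x)
  (D_trans : forall x y z, D x y -> D y z -> D x z)
  (D_closed : forcing_closed D) (Dab : ~ D a b) (Dba : ~ D b a)
  (C_asym : forall x y, forced a b x y -> ~ forced a b y x).
Local Notation C := (forced a b).

(* This is the triangle lemma of the theory of transitive orientations. *)
Lemma forced_triangle x y w : C x y -> (C x w \/ C w y) <-> (C a w \/ C w b).
Proof.
elim=> // j {}x {}y z sep Cxy IH; rewrite -IH; have /and3P[xj zj yj] := sep.
  have [wj|wj] := boolP (X j w).
    have [xw_y _] := @forced_closed a b j x y w (separatesI xj wj yj).
    have Cwy : C w y by apply/xw_y.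
    by split; right.
  have [xz_w _] := @forced_closed a b j x w z (separatesI xj zj wj).
  by rewrite xz_w.
have [wj|wj] := boolP (X j w).
  have [_ y_xw] := @forced_closed a b j x y w (separatesI xj wj yj).
  have Cyw : C y w by apply/y_xw.
  by split; left.
have [_ w_xz] := @forced_closed a b j x w z (separatesI xj zj wj).
by rewrite w_xz.
Qed.

Lemma forced_trans x y z : C x y -> C y z -> C x z.
Proof.
move=> Cxy Cyz.
have [/(C_asym Cxy)//|//] : C y x \/ C x z.
by apply/(forced_triangle _ Cyz)/(forced_triangle _ Cxy); right.
Qed.

Lemma forced_incomparable x y : C x y -> ~ D x y /\ ~ D y x.
Proof.
move=> Cxy; split=> [/(forced_iff D_closed Cxy)//|].
by move/(forced_iff (forcing_closed_converse D_closed) Cxy).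
Qed.

Lemma forced_sandwich u v u' v' : C u v -> weak D v u' -> C u' v' -> C u v'.
Proof.
move=> Cuv vu' Cu'v'; case: vu' => [vE|Dvu'].
  by rewrite vE in Cuv; apply: forced_trans Cu'v'.
apply: (@forced_trans _ u') => //.
have [//|/forced_incomparable[_]//] : C u u' \/ C u' v.
by apply/(forced_triangle _ Cuv)/(forced_triangle _ Cu'v'); right.
Qed.

Lemma weak_trans x y z : weak D x y -> weak D y z -> weak D x z.
Proof.
case=> [->//|Dxy] [<-|Dyz]; first by right.
by right; apply: D_trans Dyz.
Qed.

Lemma extension_irr x : ~ extension D a b x x.
Proof.
case=> [/D_irr//|[u [v [xu Cuv vx]]]].
case: (weak_trans vx xu) => [vu|Dvu]; first by rewrite vu in Cuv; apply: (C_asym Cuv).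
by have [] := forced_incomparable Cuv.
Qed.

Lemma extension_trans x y z :
  extension D a b x y -> extension D a b y z -> extension D a b x z.
Proof.
case=> [Dxy|[u [v [xu Cuv vy]]]] [Dyz|[u' [v' [yu' Cu'v' v'z]]]].
- by left; apply: D_trans Dyz.
- by right; exists u', v'; split=> //; apply: weak_trans yu'; right.
- by right; exists u, v; split=> //; apply: weak_trans vy _; right.
- right; exists u, v'; split=> //.
  exact: forced_sandwich (weak_trans vy yu') Cu'v'.
Qed.

End Order.
End ForcedPairs.

(** * Products of symmetric groups on intervals *)

Section SymProducts.
Variable U : finType.
Implicit Types (A : {set U}) (s : seq {set U}) (t u : {perm U}) (x y : U).
Local Open Scope group_scope.

Fixpoint sym_product s t : bool :=
  if s is A :: s' then [exists u in Sym A, sym_product s' (u^-1 * t)] else t == 1.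

Lemma sym_product_consP A s t :
  reflect (exists2 u, u \in Sym A & sym_product s (u^-1 * t)) (sym_product (A :: s) t).
Proof. exact: exists_inP. Qed.

Lemma sym_productP (I : eqType) (r : seq I) (X : I -> {set U}) t : uniq r ->
  (exists sigma : I -> {perm U},
     (forall i, sigma i \in Sym (X i)) /\ t = \prod_(i <- r) sigma i)
  <-> sym_product (map X r) t.
Proof.
elim: r t => [|i r IH] t.
  move=> _; split=> [[sigma [_ ->]]|/eqP->]; first by rewrite big_nil /=.
  by exists (fun=> 1); rewrite big_nil; split=> // i; apply: group1.
case/andP=> i_notin r_uniq; split=> [[sigma [sigma_in ->]]|/sym_product_consP[u u_in]].
  apply/sym_product_consP; exists (sigma i) => //; apply/IH => //; exists sigma; split=> //.
  by rewrite big_cons mulKg.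
case/IH=> // sigma [sigma_in prodE].
exists (fun k => if k == i then u else sigma k); split=> [k|]; first by case: eqP => [->|].
rewrite big_cons eqxx -[t](mulKVg u) prodE; congr (_ * _).
by apply: eq_big_seq => k k_in; case: eqP i_notin => // <-; rewrite k_in.
Qed.

Lemma sym_id A u x : u \in Sym A -> x \notin A -> u x = x.
Proof. by rewrite inE => uA xA; apply: out_perm uA xA. Qed.

Lemma sym_closed A u x : u \in Sym A -> (u x \in A) = (x \in A).
Proof. by rewrite inE => uA; apply: perm_closed. Qed.

Lemma tperm_sym A x y : x \in A -> y \in A -> tperm x y \in Sym A.
Proof.
move=> xA yA; rewrite inE; apply/subsetP => z; rewrite inE.
by case: tpermP => [->|->|]; rewrite ?eqxx.
Qed.

Lemma sym_product_mul A s t u :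
  u \in Sym A -> sym_product (A :: s) (u * t) = sym_product (A :: s) t.
Proof.
suff imp t' u' : u' \in Sym A -> sym_product (A :: s) t' -> sym_product (A :: s) (u' * t').
  by move=> uA; apply/idP/idP=> [/(imp _ u^-1)|]; rewrite ?mulKg ?groupV; [apply|apply: imp].
move=> u'A /sym_product_consP[v vA prod_v]; apply/sym_product_consP; exists (u' * v).
  exact: groupM.
by rewrite invMg mulgA mulgKV.
Qed.

Lemma sym_product_weaken A s t : sym_product s t -> sym_product (A :: s) t.
Proof.
by move=> prod_t; apply/sym_product_consP; exists 1; rewrite ?group1 // invg1 mul1g.
Qed.

Section Order.
Variable lt : rel U.
Hypotheses (lt_irr : irreflexive lt) (lt_trans : transitive lt)
  (lt_total : forall x y, x != y -> lt x y || lt y x).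

Lemma lt_asym x y : lt x y -> lt y x = false.
Proof. by move=> xy; apply/negP => /(lt_trans xy); rewrite lt_irr. Qed.

Lemma lt_neq x y : lt x y -> x != y.
Proof. by apply: contraTneq => ->; rewrite lt_irr. Qed.

Lemma nlt_lt x y : x != y -> ~~ lt x y -> lt y x.
Proof. by move=> /lt_total /orP[->|]. Qed.

Definition rank x : nat := #|[set y | lt y x]|.

Lemma rank_lt x y : lt x y -> rank x < rank y.
Proof.
move=> xy; apply/proper_card/properP; split.
  by apply/subsetP => z; rewrite !inE => zx; apply: lt_trans xy.
by exists x; rewrite !inE ?lt_irr.
Qed.

Definition sortedness t : nat := (\sum_x rank x * rank (t x))%N.

Lemma sortedness_bound t : (sortedness t <= #|U| * (#|U| * #|U|))%N.
Proof.
by rewrite -sum_nat_const; apply: leq_sum => x _; apply: leq_mul; apply: max_card.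
Qed.

(* Rearrangement inequality. *)
Lemma sortedness_swap t x y :
  lt x y -> lt (t y) (t x) -> (sortedness t < sortedness (tperm x y * t)%g)%N.
Proof.
move=> xy tyx; have yx : y != x by rewrite eq_sym lt_neq.
rewrite /sortedness (bigD1 x) // (bigD1 y) //=.
rewrite [X in _ < X](bigD1 x) // [X in _ < _ + X](bigD1 y) //=.
rewrite !permM tpermL tpermR !addnA.
have -> : (\sum_(i | (i != x) && (i != y)) rank i * rank (t i) =
          \sum_(i | (i != x) && (i != y)) rank i * rank ((tperm x y * t)%g i))%N.
  by apply: eq_bigr => i /andP[ix iy]; rewrite permM tpermD // eq_sym.
by rewrite ltn_add2r; have := rank_lt xy; have := rank_lt tyx; nia.
Qed.

Definition interval A : Prop :=
  forall x y z, lt x y -> lt y z -> x \in A -> z \in A -> y \in A.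

Lemma inversion_in_interval A u x y :
  interval A -> u \in Sym A -> lt x y -> lt (u y) (u x) -> (x \in A) && (y \in A).
Proof.
move=> A_int uA xy uyx; apply: contraTT uyx; rewrite negb_and => notin.
case: (boolP (x \in A)) notin => /= xA; case: (boolP (y \in A)) => // yA _.
- rewrite (sym_id uA yA); apply: contra yA => yux.
  by apply: (A_int x y (u x)); rewrite ?sym_closed.
- rewrite (sym_id uA xA); apply: contra xA => uyx.
  by apply: (A_int (u y) x y); rewrite ?sym_closed.
- by rewrite !(sym_id uA) // lt_asym.
Qed.

(* Products of symmetric groups on intervals form a lower set of the Bruhat
   order. *)
Lemma sym_product_swap s t x y :
  (forall A, A \in s -> interval A) ->
  sym_product s t -> lt x y -> lt (t y) (t x) -> sym_product s (tperm x y * t).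
Proof.
elim: s t x y => [|A s IH] t x y s_int.
  by move=> /= /eqP->; rewrite !perm1 => /lt_asym->.
move=> /[dup] prod_t /sym_product_consP[u uA prod_u] xy tyx.
have A_int : interval A by apply: s_int; rewrite inE eqxx.
have uxy : u x != u y by rewrite (inj_eq perm_inj) lt_neq.
have [lt_uxy|nlt_uxy] := boolP (lt (u x) (u y)); last first.
  have /andP[xA yA] := inversion_in_interval A_int uA xy (nlt_lt uxy nlt_uxy).
  by rewrite sym_product_mul ?tperm_sym.
apply/sym_product_consP; exists u => //.
have -> : u^-1 * (tperm x y * t) = tperm (u x) (u y) * (u^-1 * t).
  by rewrite -tpermJ conjgE !mulgA mulgK.
apply: IH => //; last by rewrite !permM !permK.
by move=> B Bs; apply: s_int; rewrite inE Bs orbT.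
Qed.

Definition sorted_on A t : Prop :=
  forall x y, x \in A -> y \in A -> lt x y -> lt (t x) (t y).

Lemma sorted_sym_id A u : u \in Sym A -> sorted_on A u -> u = 1.
Proof.
move=> uA u_sorted; apply/permP => x0; rewrite perm1; apply/eqP; apply: contraT => ux0.
have [x ux x_min] := @arg_minnP _ x0 (fun x => u x != x) rank ux0.
have fixed_below y : lt y x -> u y = y.
  by move=> /rank_lt yx; apply/eqP; apply: contraLR yx => /x_min; rewrite -leqNgt.
have xA : x \in A by apply: contraR ux => /(sym_id uA)->.
have xux : lt x (u x).
  by apply: (nlt_lt ux); apply: contra ux => /fixed_below/perm_inj->.
have uVx : u^-1 x != x by apply: contra ux => /eqP{1}<-; rewrite permKV.
have xuVx : lt x (u^-1 x).
  apply: (nlt_lt uVx); apply: contra uVx => /fixed_below; rewrite permKV => {2}->.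
  by rewrite eqxx.
have uVxA : u^-1 x \in A by rewrite -(sym_closed _ uA) permKV.
by have := u_sorted _ _ xA uVxA xuVx; rewrite permKV lt_asym.
Qed.

Lemma sorted_coset_unique A t u :
  u \in Sym A -> sorted_on A t -> sorted_on A (u^-1 * t) -> u = 1.
Proof.
move=> uA t_sorted ut_sorted; apply: invg_inj; rewrite invg1.
apply: sorted_sym_id (_ : u^-1 \in Sym A) _; first by rewrite groupV.
move=> x y xA yA xy; have xyV : u^-1 y != u^-1 x.
  by rewrite (inj_eq perm_inj) eq_sym lt_neq.
apply: (nlt_lt xyV); apply/negP => uVyx.
have uVA z : z \in A -> u^-1 z \in A by rewrite sym_closed ?groupV.
have := ut_sorted _ _ xA yA xy; rewrite !permM.
by rewrite lt_asym // t_sorted ?uVA.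
Qed.

Lemma sym_product_sorted A s t :
  (forall B, B \in s -> interval B) -> sorted_on A t ->
  sym_product (A :: s) t = sym_product s t.
Proof.
move=> s_int t_sorted; apply/idP/idP; last exact: sym_product_weaken.
case/sym_product_consP=> u0 u0A prod_u0.
pose factor u := (u \in Sym A) && sym_product s (u^-1 * t).
have [|u /andP[uA prod_u] u_max] :=
  @arg_maxnP _ u0 factor (fun u => sortedness (u^-1 * t)); first exact/andP.
have ut_sorted : sorted_on A (u^-1 * t).
  move=> x y xA yA xy; apply: nlt_lt; first by rewrite (inj_eq perm_inj) eq_sym lt_neq.
  apply/negP => tyx; have swapE : (u * tperm x y)^-1 * t = tperm x y * (u^-1 * t).
    by rewrite invMg tpermV mulgA.
  have := u_max (u * tperm x y); rewrite /factor swapE groupM ?tperm_sym // sym_product_swap //.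
  by move=> /(_ isT) /=; rewrite leqNgt sortedness_swap.
by have u1 := sorted_coset_unique uA t_sorted ut_sorted; rewrite u1 invg1 mul1g in prod_u.
Qed.

End Order.
End SymProducts.

(** * Saturation *)

Lemma foldl_map (T1 T2 R : Type) (h : T1 -> T2) (f : R -> T2 -> R) z s :
  foldl f z (map h s) = foldl (fun z x => f z (h x)) z s.
Proof. by elim: s z => //= x s IH z; rewrite IH. Qed.

Section Saturation.
Variables (A : Type) (T : eqType).
Variables (fires : T -> A -> bool) (action : T -> A -> A) (ts : seq T).

Definition fire (t : T) (a : A) : A := if fires t a then action t a else a.
Definition sweep (a : A) : A := foldl (fun a t => fire t a) a ts.

Lemma sweep_idle a : {in ts, forall t, ~~ fires t a} -> sweep a = a.
Proof.
rewrite /sweep; elim: ts => //= t r IH idle; rewrite /fire ifN ?idle ?mem_head //.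
by apply: IH => u ur; apply: idle; rewrite inE ur orbT.
Qed.

Variables (inv : A -> Prop) (mu : A -> nat).
Hypothesis action_progress :
  forall t a, t \in ts -> inv a -> fires t a -> inv (action t a) /\ mu (action t a) < mu a.

Lemma sweep_progress a : inv a ->
  inv (sweep a) /\
  (sweep a = a /\ {in ts, forall t, ~~ fires t a} \/ mu (sweep a) < mu a).
Proof.
rewrite /sweep; elim: ts a action_progress => [|t r IH] a progress inv_a /=.
  by split=> //; left.
have progress_r u b : u \in r -> inv b -> fires u b -> inv (action u b) /\ mu (action u b) < mu b.
  by move=> ur; apply: progress; rewrite inE ur orbT.
rewrite /fire; have [fires_t|idle_t] := boolP (fires t a).
  have [inv_ta mu_ta] := progress t a (mem_head t r) inv_a fires_t.
  have [inv_r [[-> _]|mu_r]] := IH _ progress_r inv_ta; split=> //; right=> //.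
  exact: ltn_trans mu_ta.
have [inv_r [[aE idle_r]|mu_r]] := IH _ progress_r inv_a; split=> //; [left|by right].
by split=> // u; rewrite inE => /predU1P[->|/idle_r].
Qed.

Lemma iter_sweep_saturates n a : inv a -> mu a < n ->
  inv (iter n sweep a) /\ {in ts, forall t, ~~ fires t (iter n sweep a)}.
Proof.
move=> inv_a mu_lt; suff [inv_n [//|mu_n]] : inv (iter n sweep a) /\
    ({in ts, forall t, ~~ fires t (iter n sweep a)} \/ mu (iter n sweep a) + n <= mu a).
  by have := leq_trans mu_lt (leq_trans (leq_addl _ n) mu_n); rewrite ltnn.
elim: n {mu_lt} => [|n [inv_n IH]] /=; first by split=> //; right; rewrite addn0.
have [inv_n1 [[-> idle]|mu_n1]] := sweep_progress inv_n; split=> //; first by left.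
case: IH => [idle|mu_n]; last by right; lia.
by left; rewrite sweep_idle.
Qed.

End Saturation.

(** * Loops of array programs *)

Section Loops.
Variables (S : finType) (N : nat).
Notation cmd := (cmd S).
Notation memory := (memory S).
Notation arrays := (nat -> nat -> cell S).
Notation exec := (@exec S N).
Implicit Types (c : cmd) (m : memory) (xs t : seq nat).

Lemma execE :
  ((forall m, exec CSkip m = m) *
   (forall c1 c2 m, exec (CSeq c1 c2) m = exec c2 (exec c1 m)) *
   (forall x e m, exec (CSet x e) m = set_var m x (minn (eval N (vars m) e) N)) *
   (forall a e x m, exec (CWrite a e x) m = set_arr m a (eval N (vars m) e) x) *
   (forall a e x c1 c2 m, exec (CIf a e x c1 c2) m =
      if arrs m a (eval N (vars m) e) == x then exec c1 m else exec c2 m) *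
   (forall e c m, exec (CRepeat e c) m = iter (eval N (vars m) e) (exec c) m))%type.
Proof. by []. Qed.

Definition CFor (x : nat) (e : expr) c : cmd :=
  CSeq (CSet x (EConst 0))
       (CRepeat e (CSeq c (CSet x (EAdd (EVar x) (EConst 1))))).

Fixpoint assigned c : seq nat :=
  match c with
  | CSkip | CWrite _ _ _ => [::]
  | CSeq c1 c2 | CIf _ _ _ c1 c2 => assigned c1 ++ assigned c2
  | CSet x _ => [:: x]
  | CRepeat _ c => assigned c
  end.

Lemma vars_exec c m : {in [predC assigned c], vars (exec c m) =1 vars m}.
Proof.
move=> x; rewrite inE.
elim: c m => //= [c1 IH1 c2 IH2|y e|a e y c1 IH1 c2 IH2|e c IH] m.
- by rewrite mem_cat negb_or => /andP[x1 x2]; rewrite IH2 ?IH1.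
- by rewrite inE => /negbTE ->.
- by rewrite mem_cat negb_or => /andP[x1 x2]; case: eqP => _; [apply: IH1|apply: IH2].
- by move=> xc; elim: (eval _ _ _) => //= k IHk; rewrite IH.
Qed.

Lemma exec_for (I : nat -> memory -> Prop) x e c m k :
  eval N (vars (set_var m x 0)) e = k -> k <= N -> x \notin assigned c ->
  I 0 (set_var m x 0) ->
  (forall i m', i < k -> vars m' x = i -> I i m' ->
     I i.+1 (set_var (exec c m') x i.+1)) ->
  I k (exec (CFor x e c) m).
Proof.
move=> e_k k_le x_free I0 I_step; rewrite /CFor !execE min0n e_k.
set body := exec (CSeq c _).
suff iterations i : i <= k -> let m' := iter i body (set_var m x 0) in I i m' /\ vars m' x = i.
  by have [] := iterations k (leqnn k).
elim: i => [|i IH] i_lt /=; first by rewrite eqxx.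
have [Ii x_i] := IH (ltnW i_lt).
rewrite {1 3}/body !execE /= vars_exec // x_i eqxx (minn_idPl _) ?addn1 ?(leq_trans i_lt) //.
by split=> //; apply: I_step.
Qed.

Fixpoint CIfAll (conds : seq (nat * expr * bool)) c1 c2 : cmd :=
  if conds is (a, e, b) :: conds' then
    if b then CIf a e (mark true) (CIfAll conds' c1 c2) c2
    else CIf a e (mark true) c2 (CIfAll conds' c1 c2)
  else c1.

Definition holds m (cond : nat * expr * bool) : bool :=
  (arrs m cond.1.1 (eval N (vars m) cond.1.2) == mark true) == cond.2.

Lemma exec_ifall conds c1 c2 m :
  exec (CIfAll conds c1 c2) m = if all (holds m) conds then exec c1 m else exec c2 m.
Proof.
elim: conds => //= -[[a e] []] conds IH /=; rewrite /holds /= -/(holds m) IH;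
  by case: (arrs m a _ == _).
Qed.

Definition nest xs c : cmd := foldr (fun x => CFor x ESize) c xs.

Fixpoint tuples (k : nat) : seq (seq nat) :=
  if k is k'.+1 then [seq i :: t | i <- iota 0 N, t <- tuples k'] else [:: [::]].

Lemma mem_tuples k t : (t \in tuples k) = (size t == k) && all (ltn^~ N) t.
Proof.
elim: k t => [|k IH] [|i t] //=.
  by apply/negP => /allpairsP[[j u] []].
rewrite eqSS andbCA -IH; apply/allpairsP/andP => [[[j u] /= [j_in u_in [-> ->]]]|[i_lt t_in]].
  by move: j_in; rewrite mem_iota.
by exists (i, t); rewrite mem_iota.
Qed.
Arguments tuples : simpl never.

Lemma assigned_nest xs c : assigned c = [::] -> assigned (nest xs c) =i xs.
Proof.
move=> pure_c y; elim: xs => [|x xs IH] /=; first by rewrite pure_c.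
by rewrite inE mem_cat IH inE orbCA orbb orbC.
Qed.

Lemma exec_nest xs c (f : seq nat -> arrays -> arrays) m :
  uniq xs -> assigned c = [::] ->
  (forall m', {in [predC xs], vars m' =1 vars m} ->
     map (vars m') xs \in tuples (size xs) ->
     arrs (exec c m') = f (map (vars m') xs) (arrs m')) ->
  arrs (exec (nest xs c) m) = foldl (fun A t => f t A) (arrs m) (tuples (size xs)).
Proof.
move=> + pure_c; elim: xs f m => [|x xs IH] f m; first by move=> _; apply.
rewrite [uniq _]/= => /andP[x_notin xs_uniq] c_f.
pose I i m' := {in [predC x :: xs], vars m' =1 vars m} /\
  arrs m' = foldl (fun A t => f t A) (arrs m) [seq j :: t | j <- iota 0 i, t <- tuples (size xs)].
suff [//] : I N (exec (nest (x :: xs) c) m).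
have drop_x m' y : y \in [predC x :: xs] -> vars (set_var m' x 0) y = vars m' y.
  by rewrite !inE negb_or => /andP[/negbTE /= ->].
apply: exec_for => //=; first by rewrite assigned_nest.
  by split=> // y /drop_x.
move=> i m' i_lt x_i [vars_m' arrs_m'].
have IHi := IH (fun t => f (i :: t)) m' xs_uniq.
split=> [y y_out|].
  move: (y_out); rewrite /= !inE negb_or => /andP[/negbTE-> y_xs].
  by rewrite vars_exec ?inE ?assigned_nest // vars_m'.
rewrite [arrs (set_var _ _ _)]/= IHi => [|m'' vars_m'' t_in].
  rewrite -[i.+1]addn1 iotaD map_cat flatten_cat foldl_cat -arrs_m' add0n /= cats0.
  by rewrite foldl_map.
have x_i'' : vars m'' x = i by rewrite vars_m'' ?inE.
have := c_f m''; rewrite /= x_i''; apply.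
  move=> y y_out; rewrite vars_m'' ?vars_m' //.
  by move: y_out; rewrite !inE negb_or => /andP[].
by move: t_in; rewrite !mem_tuples /= !size_map !eqxx /= i_lt.
Qed.

Lemma repeat_saturates xs c fires action inv mu e m :
  uniq xs -> assigned c = [::] ->
  (forall m', {in [predC xs], vars m' =1 vars m} ->
     map (vars m') xs \in tuples (size xs) ->
     arrs (exec c m') = fire fires action (map (vars m') xs) (arrs m')) ->
  (forall t A, t \in tuples (size xs) -> inv A -> fires t A ->
     inv (action t A) /\ mu (action t A) < mu A) ->
  inv (arrs m) -> mu (arrs m) < eval N (vars m) e ->
  let A := arrs (exec (CRepeat e (nest xs c)) m) in
  inv A /\ {in tuples (size xs), forall t, ~~ fires t A}.
Proof.
move=> xs_uniq pure_c c_rule progress inv_m mu_lt /=.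
have arrs_iter n : arrs (iter n (exec (nest xs c)) m) =
    iter n (sweep fires action (tuples (size xs))) (arrs m).
  suff [//] : {in [predC xs], vars (iter n (exec (nest xs c)) m) =1 vars m} /\
      arrs (iter n (exec (nest xs c)) m)
      = iter n (sweep fires action (tuples (size xs))) (arrs m).
  elim: n => //= n [vars_n <-]; split=> [y y_out|].
    by rewrite vars_exec ?vars_n // inE assigned_nest.
  apply: exec_nest => // m' vars_m'; apply: c_rule => y y_out.
  by rewrite vars_m' ?vars_n.
by rewrite arrs_iter; apply: (iter_sweep_saturates progress).
Qed.

End Loops.
Arguments exec : simpl never.

(** * Computing a consecutive ordering *)

(* The elements of ['I_n] are represented by 1, ..., n as in the input. Array 1
   holds the order relation, row [j + 2] of array 2 the [j]-th set (in the input
   the sets come after two other lists), row [N + x] of array 3 the image of [x]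
   under the current permutation, and array 4 is marked in order to reject. *)
Notation order_arr := 1 (only parsing).
Notation sets_arr := 2 (only parsing).
Notation image_arr := 3 (only parsing).
Notation reject_arr := 4 (only parsing).

Notation var_a := 5 (only parsing).
Notation var_b := 6 (only parsing).
Notation var_x := 7 (only parsing).
Notation var_y := 8 (only parsing).
Notation var_z := 9 (only parsing).
Notation var_j := 10 (only parsing).

Section BitMatrices.
Variables (S : finType) (N : nat).
Notation arrays := (nat -> nat -> cell S).
Implicit Types A B : arrays.

Definition bit A (a p q : nat) : bool := A a (p * N + q) == mark true.

Definition set_bit A (a p q : nat) (b : bool) : arrays := set_cell A a (p * N + q) (mark b).

Lemma mark_true b : (mark b == mark true :> cell S) = b.
Proof. by case: b. Qed.

Lemma eq_entry p q p' q' : q < N -> q' < N ->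
  (p * N + q == p' * N + q') = (p == p') && (q == q').
Proof.
move=> q_lt q'_lt; apply/eqP/andP => [entryE|[/eqP-> /eqP->]] //.
have N_gt0 : 0 < N by lia.
have pE : p = p'.
  by have := congr1 (divn^~ N) entryE; rewrite !divnMDl // !divn_small // !addn0.
by split; apply/eqP => //; move: entryE; rewrite pE; apply: addnI.
Qed.

Lemma bit_set A a a' p p' q q' b : q < N -> q' < N ->
  bit (set_bit A a p q b) a' p' q' =
  if [&& a' == a, p' == p & q' == q] then b else bit A a' p' q'.
Proof.
move=> q_lt q'_lt; rewrite /bit /set_bit /set_cell eq_entry //.
by case: ifP => // _; rewrite mark_true.
Qed.

Definition same_but (a : nat) A B : Prop := forall b, b != a -> A b =1 B b.

Lemma same_but_set A B a p q b : same_but a A B -> same_but a (set_bit A a p q b) B.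
Proof. by move=> AB c c_a i; rewrite /set_bit /set_cell (negbTE c_a) AB. Qed.

Lemma same_but_trans a A B C : same_but a A B -> same_but a B C -> same_but a A C.
Proof. by move=> AB BC c c_a i; rewrite AB ?BC. Qed.

Lemma bit_same A B a c p q : same_but a A B -> c != a -> bit A c p q = bit B c p q.
Proof. by move=> AB c_a; rewrite /bit AB. Qed.

Definition ordr A (x y : 'I_N) : bool := bit A order_arr x y.
Definition member A (j x : 'I_N) : bool := bit A sets_arr (j + 2) x.

Lemma same_member A B : same_but order_arr A B -> member A =2 member B.
Proof. by move=> AB j x; apply: bit_same AB _. Qed.

Lemma same_forcing_closed A B D :
  same_but order_arr A B -> forcing_closed (member A) D -> forcing_closed (member B) D.
Proof.
by move=> AB D_closed j x y z; rewrite /separates -!(same_member AB); apply: D_closed.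
Qed.

Definition missing A : nat := #|[set p : 'I_N * 'I_N | ~~ ordr A p.1 p.2]|.

Lemma missing_set A (x y : 'I_N) :
  ~~ ordr A x y -> missing (set_bit A order_arr x y true) < missing A.
Proof.
move=> nxy; apply/proper_card/properP; split.
  by apply/subsetP => -[u v]; rewrite !inE /ordr bit_set //; case: ifP.
by exists (x, y); rewrite !inE // /ordr bit_set // !eqxx.
Qed.

Lemma ordr_set A (x y u v : 'I_N) :
  ordr (set_bit A order_arr x y true) u v = ((u, v) == (x, y)) || ordr A u v.
Proof. by rewrite /ordr bit_set // xpair_eqE -!val_eqE eqxx; case: (_ && _). Qed.

End BitMatrices.

Section OrderStage.
Variables (S : finType) (N : nat).
Notation arrays := (nat -> nat -> cell S).
Notation exec := (@exec S N).
Notation bit := (@bit S N).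
Notation set_bit := (@set_bit S N).
Notation ordr := (@ordr S N).
Notation member := (@member S N).
Implicit Types (A : arrays) (m : memory S) (t : seq nat).

Definition entry (e1 e2 : expr) : expr := EAdd (EMul e1 ESize) e2.

Definition order_test (x y : nat) (b : bool) : nat * expr * bool :=
  (order_arr, entry (EVar x) (EVar y), b).
Definition member_test (j x : nat) (b : bool) : nat * expr * bool :=
  (sets_arr, entry (EAdd (EVar j) (EConst 2)) (EVar x), b).
Definition write_order (x y : nat) : cmd S :=
  CWrite order_arr (entry (EVar x) (EVar y)) (mark true).

Definition closure_rule : cmd S :=
  CIfAll [:: order_test var_x var_y true; order_test var_y var_z true;
             order_test var_x var_z false]
    (write_order var_x var_z)
 (CIfAll [:: member_test var_j var_x true; member_test var_j var_z true;
             member_test var_j var_y false;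
             order_test var_x var_y true; order_test var_z var_y false]
    (write_order var_z var_y)
 (CIfAll [:: member_test var_j var_x true; member_test var_j var_z true;
             member_test var_j var_y false;
             order_test var_y var_x true; order_test var_y var_z false]
    (write_order var_y var_z)
    CSkip)).

Definition close_order : cmd S :=
  CRepeat (EAdd (EMul ESize ESize) (EConst 1))
    (nest [:: var_x; var_y; var_z; var_j] closure_rule).

Definition orient_pair : cmd S :=
  CIfAll [:: order_test var_a var_b false; order_test var_b var_a false]
    (CSeq (write_order var_a var_b) close_order) CSkip.

Definition order_stage : cmd S :=
  CFor var_a ESize (CFor var_b (EVar var_a) orient_pair).

Definition closure_pair t A : option (nat * nat) :=
  if t is [:: x; y; z; j] then
    let separated := [&& bit A sets_arr (j + 2) x, bit A sets_arr (j + 2) z &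
                         ~~ bit A sets_arr (j + 2) y] in
    if [&& bit A order_arr x y, bit A order_arr y z & ~~ bit A order_arr x z]
    then Some (x, z)
    else if [&& separated, bit A order_arr x y & ~~ bit A order_arr z y] then Some (z, y)
    else if [&& separated, bit A order_arr y x & ~~ bit A order_arr y z] then Some (y, z)
    else None
  else None.

Definition closure_fires t A : bool := closure_pair t A.
Definition closure_action t A : arrays :=
  if closure_pair t A is Some p then set_bit A order_arr p.1 p.2 true else A.

Lemma exec_closure_rule m :
  arrs (exec closure_rule m) =
  fire closure_fires closure_action (map (vars m) [:: var_x; var_y; var_z; var_j]) (arrs m).
Proof.
rewrite /closure_rule !exec_ifall !execE /= /holds /= -!/(bit (arrs m) _ _ _).
rewrite !eqb_id !eqbF_neg !andbT /fire /closure_fires /closure_action /= -!andbA.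
by do 3!case: ifP => //= _.
Qed.

Section Closure.
Variables (A0 : arrays) (R : 'I_N -> 'I_N -> Prop).
Hypotheses (R_trans : forall x y z, R x y -> R y z -> R x z)
  (R_closed : forcing_closed (member A0) R).

Definition closure_inv A : Prop :=
  [/\ same_but order_arr A A0, subrel (ordr A0) (ordr A) & forall x y, ordr A x y -> R x y].

Lemma closure_pair_sound t A p : t \in tuples N 4 -> closure_inv A ->
  closure_pair t A = Some p ->
  exists x y : 'I_N, [/\ p = (val x, val y), R x y & ~~ ordr A x y].
Proof.
rewrite mem_tuples; case: t => [|x [|y [|z [|j []]]]] //= /and5P[x_lt y_lt z_lt j_lt _].
move=> [AA0 _ AR]; pose x' := Ordinal x_lt; pose y' := Ordinal y_lt; pose z' := Ordinal z_lt.
pose j' := Ordinal j_lt.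
have R_closedA : forcing_closed (member A) R.
  by apply: same_forcing_closed R_closed => c c_order i; rewrite AA0.
case: ifP => [/and3P[xy yz nxz] [<-]|_].
  by exists x', z'; split=> //; apply: R_trans (AR x' y' xy) (AR y' z' yz).
case: ifP => [/and3P[sep xy nzy] [<-]|_].
  by exists z', y'; split=> //; have [xz_y _] := R_closedA j' x' y' z' sep; apply/xz_y/AR.
case: ifP => [/and3P[sep yx nyz] [<-]|//].
by exists y', z'; split=> //; have [_ y_xz] := R_closedA j' x' y' z' sep; apply/y_xz/AR.
Qed.

Lemma closure_progress t A :
  t \in tuples N 4 -> closure_inv A -> closure_fires t A ->
  closure_inv (closure_action t A) /\ missing N (closure_action t A) < missing N A.
Proof.
rewrite /closure_fires /closure_action => t_in inv; case tE: closure_pair => [p|//] _.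
have [x [y [-> Rxy nxy]]] := closure_pair_sound t_in inv tE.
have [AA0 A0A AR] := inv; split; last exact: missing_set.
split=> [|u v uv|u v]; first exact: same_but_set.
  by rewrite ordr_set A0A ?orbT.
by rewrite ordr_set => /orP[/eqP[-> ->]|/AR].
Qed.

End Closure.

Lemma closure_idle A : {in tuples N 4, forall t, ~~ closure_fires t A} ->
  transitive (ordr A) /\ forcing_closed (member A) (ordr A).
Proof.
move=> idle; have no_pair (x y z j : 'I_N) :
    closure_pair [:: val x; val y; val z; val j] A = None.
  set t := [:: _; _; _; _]; have /idle : t \in tuples N 4 by rewrite mem_tuples /= !ltn_ord.
  by rewrite /closure_fires; case: (closure_pair t A).
split=> [y x z xy yz|]; last (apply: forcing_closedI => j x y z sep; have := no_pair x y z j).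
  by have := no_pair x y z x; rewrite /= -!/(ordr A _ _) xy yz /=; case: ifP => // /negbFE.
rewrite /= -!/(ordr A _ _) -!/(member A _ _) -/(separates _ _ _ _ _) sep /=.
case: ifP => // _; case: ifP => // n_left; case: ifP => // n_right _.
split=> [xy|yx]; [move: n_left; rewrite xy|move: n_right; rewrite yx]; exact: negbFE.
Qed.

Lemma close_order_spec m (R : 'I_N -> 'I_N -> Prop) :
  (forall x y z, R x y -> R y z -> R x z) -> forcing_closed (member (arrs m)) R ->
  (forall x y, ordr (arrs m) x y -> R x y) ->
  let A := arrs (exec close_order m) in
  [/\ closure_inv (arrs m) R A, transitive (ordr A) & forcing_closed (member A) (ordr A)].
Proof.
move=> R_trans R_closed order_R.
have [||||inv idle] := @repeat_saturates S N [:: var_x; var_y; var_z; var_j] closure_rule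
  closure_fires closure_action (closure_inv (arrs m) R) (missing N)
  (EAdd (EMul ESize ESize) (EConst 1)) m erefl erefl.
- by move=> m' _ _; apply: exec_closure_rule.
- by move=> t A; apply: closure_progress.
- by split.
- by rewrite /= addn1 ltnS (leq_trans (max_card _)) // card_prod card_ord.
by have [tr cl] := closure_idle idle; split.
Qed.

Definition good_order A0 A : Prop :=
  [/\ same_but order_arr A A0, irreflexive (ordr A), transitive (ordr A) &
      forcing_closed (member A0) (ordr A)].

Definition comparable A (x y : 'I_N) : bool := ordr A x y || ordr A y x.

Lemma good_order_extend A0 A (a b : 'I_N) (R := extension (member A0) (ordr A) a b) :
  (forall x y, forced (member A0) a b x y -> ~ forced (member A0) a b y x) ->
  good_order A0 A -> ~~ comparable A a b ->
  [/\ forall x, ~ R x x, forall x y z, R x y -> R y z -> R x z &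
      forcing_closed (member A0) R].
Proof.
move=> asym [_ irr tr cl]; rewrite negb_or => /andP[/negP nab /negP nba].
have irrP x : ~ ordr A x x by rewrite irr.
have trP x y z : ordr A x y -> ordr A y z -> ordr A x z by apply: tr.
split=> [x|x y z|]; first exact: extension_irr asym x.
  exact: extension_trans.
exact: extension_forcing.
Qed.

Lemma orient_pair_spec A0 m (a b : 'I_N) :
  (forall x y, forced (member A0) a b x y -> ~ forced (member A0) a b y x) ->
  vars m var_a = a -> vars m var_b = b -> good_order A0 (arrs m) ->
  let A := arrs (exec orient_pair m) in
  [/\ good_order A0 A, comparable A a b & subrel (ordr (arrs m)) (ordr A)].
Proof.
move=> asym aE bE good /=; rewrite exec_ifall /= /holds /= aE bE.
rewrite -!/(bit _ _ _ _) -!/(ordr _ _ _) !eqbF_neg andbT -negb_or -/(comparable _ a b).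
case: ifPn => [incomparable|/negPn]; last by rewrite execE; split.
set R := extension (member A0) (ordr (arrs m)) a b.
have [R_irr R_trans R_closed] := good_order_extend asym good incomparable.
have [AA0 _ _ _] := good.
rewrite !execE; set m1 := set_arr _ _ _ _.
have m1E : arrs m1 = set_bit (arrs m) order_arr a b true by rewrite /m1 /= aE bE.
have m1A0 : same_but order_arr (arrs m1) A0 by rewrite m1E; apply: same_but_set.
have m1R x y : ordr (arrs m1) x y -> R x y.
  rewrite m1E ordr_set => /orP[/eqP[-> ->]|xy]; first exact: extension_pair.
  by left.
have R_closed1 : forcing_closed (member (arrs m1)) R.
  by apply: same_forcing_closed R_closed => c ca i; rewrite m1A0.
have [[A_m1 m1A AR] A_tr A_closed] := close_order_spec R_trans R_closed1 m1R.
have A_A0 := same_but_trans A_m1 m1A0.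
split.
- split=> //; last exact: same_forcing_closed A_closed.
  by move=> x; apply/negP => /AR/R_irr.
- by rewrite /comparable m1A // m1E ordr_set eqxx.
- by move=> x y xy; apply: m1A; rewrite m1E ordr_set xy orbT.
Qed.

Definition oriented_upto A (i l : nat) : Prop :=
  forall x y : 'I_N, y < x -> (x < i) || (x == i :> nat) && (y < l) -> comparable A x y.

Section Loops.
Variable A0 : arrays.
Hypothesis forced_asym_A0 : forall a b, a != b ->
  forall x y, forced (member A0) a b x y -> ~ forced (member A0) a b y x.

Lemma orient_row_spec m (i : nat) :
  i < N -> vars m var_a = i -> good_order A0 (arrs m) -> oriented_upto (arrs m) i 0 ->
  let A := arrs (exec (CFor var_b (EVar var_a) orient_pair) m) in
  good_order A0 A /\ oriented_upto A i i.
Proof.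
move=> i_lt aE good oriented /=.
pose I l m' := [/\ vars m' var_a = i, good_order A0 (arrs m') & oriented_upto (arrs m') i l].
suff [] : I i (exec (CFor var_b (EVar var_a) orient_pair) m) by [].
apply: exec_for => //=; first exact: ltnW.
move=> l m1 l_lt bE [aE1 good1 oriented1].
pose a := Ordinal i_lt; pose b := Ordinal (ltn_trans l_lt i_lt).
have ab : a != b by rewrite -val_eqE /= gtn_eqF.
have [good2 comparable_ab mono] := orient_pair_spec (forced_asym_A0 ab) aE1 bE good1.
split=> [|//|x y yx]; first by rewrite /= vars_exec.
rewrite ltnS (leq_eqVlt y) andb_orr orbCA => /orP[/andP[/eqP xi /eqP yl]|].
  have -> : x = a by apply: val_inj.
  by have -> : y = b by apply: val_inj.
by move=> /oriented1-/(_ yx)/orP[] /mono; rewrite /comparable => ->; rewrite ?orbT.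
Qed.

Lemma order_loop_spec m :
  good_order A0 (arrs m) ->
  let A := arrs (exec order_stage m) in
  good_order A0 A /\ forall x y, x != y -> comparable A x y.
Proof.
move=> good; pose I i m' := good_order A0 (arrs m') /\ oriented_upto (arrs m') i 0.
suff : I N (exec order_stage m).
  move=> [goodN oriented]; split=> // x y; rewrite -val_eqE neq_ltn.
  case/orP=> lt_xy; [rewrite /comparable orbC|];
    by apply: oriented; rewrite ?ltn_ord.
apply: (@exec_for _ _ I) => //=; first by split=> // x y _; rewrite !ltn0 andbF.
move=> i m1 i_lt aE [good1 oriented1].
have [good2 oriented2] := orient_row_spec i_lt aE good1 oriented1; split=> // x y yx.
rewrite andbF orbF ltnS leq_eqVlt => x_le; apply: oriented2 => //.
by case: eqP x_le => [<-|_] /=; rewrite ?yx ?orbT ?orbF.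
Qed.

End Loops.

Lemma order_stage_spec m :
  (forall a b, a != b -> forall x y, forced (member (arrs m)) a b x y ->
     ~ forced (member (arrs m)) a b y x) ->
  (forall i, arrs m order_arr i = mark false) ->
  let A := arrs (exec order_stage m) in
  good_order (arrs m) A /\ forall x y, x != y -> comparable A x y.
Proof.
move=> forced_asym_m order_empty; apply: order_loop_spec => //.
have no_order x y : ordr (arrs m) x y = false by rewrite /ordr /bit order_empty.
by split=> // [y x z|j x y z]; rewrite !no_order.
Qed.

End OrderStage.

(** * Sorting the permutation *)

Section SortStage.
Variables (S : finType) (N n : nat).
Hypothesis n_lt : n < N.
Notation arrays := (nat -> nat -> cell S).
Notation exec := (@exec S N).
Notation bit := (@bit S N).
Notation set_bit := (@set_bit S N).
Notation ordr := (@ordr S N).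
Implicit Types (A : arrays) (m : memory S) (t : seq nat) (rho : 'S_n) (i k : 'I_n).

Lemma label_lt i : i.+1 < N. Proof. exact: leq_ltn_trans (ltn_ord i) n_lt. Qed.
Definition label i : 'I_N := Ordinal (label_lt i).

Lemma label_inj : injective label.
Proof. by move=> i k /(congr1 val) [/val_inj]. Qed.

Lemma exists_label (P : pred 'I_n) i :
  [exists k : 'I_n, (i.+1 == k.+1) && P k] = P i.
Proof.
apply/existsP/idP => [[k /andP[/eqP[/val_inj->]]]|Pi] //.
by exists i; rewrite eqxx.
Qed.

Definition image_test (x y : nat) (b : bool) : nat * expr * bool :=
  (image_arr, entry (EAdd ESize (EVar x)) (EVar y), b).
Definition write_image (x y : nat) (b : bool) : cmd S :=
  CWrite image_arr (entry (EAdd ESize (EVar x)) (EVar y)) (mark b).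

Definition swap_rule : cmd S :=
  CIfAll [:: member_test var_j var_a true; member_test var_j var_b true;
             order_test var_a var_b true; image_test var_a var_x true;
             image_test var_b var_y true; order_test var_y var_x true]
    (CSeq (write_image var_a var_x false) (CSeq (write_image var_b var_y false)
    (CSeq (write_image var_a var_y true) (write_image var_b var_x true))))
    CSkip.

Definition sort_stage : cmd S :=
  CFor var_j ESize
    (CRepeat (EAdd (EMul ESize (EMul ESize ESize)) (EConst 1))
       (nest [:: var_a; var_b; var_x; var_y] swap_rule)).

Definition swap_fires (j : nat) t A : bool :=
  if t is [:: a; b; x; y] then
    [&& bit A sets_arr (j + 2) a, bit A sets_arr (j + 2) b, bit A order_arr a b,
        bit A image_arr (N + a) x, bit A image_arr (N + b) y & bit A order_arr y x]
  else false.

Definition swap_action t A : arrays :=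
  if t is [:: a; b; x; y] then
    let erased := set_bit (set_bit A image_arr (N + a) x false) image_arr (N + b) y false in
    set_bit (set_bit erased image_arr (N + a) y true) image_arr (N + b) x true
  else A.

Lemma exec_swap_rule j m : vars m var_j = j ->
  arrs (exec swap_rule m) =
  fire (swap_fires j) swap_action (map (vars m) [:: var_a; var_b; var_x; var_y]) (arrs m).
Proof.
move=> jE; rewrite /swap_rule exec_ifall /= /holds /= jE -!/(bit (arrs m) _ _ _).
by rewrite !eqb_id !andbT /fire /swap_fires /=; case: ifP; rewrite !execE.
Qed.

Definition represents A rho : Prop := forall x y, x < N -> y < N ->
  bit A image_arr (N + x) y = [exists i : 'I_n, (x == i.+1) && (y == (rho i).+1)].

Lemma represents_label A rho i y : represents A rho -> y < N ->
  bit A image_arr (N + i.+1) y = (y == (rho i).+1).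
Proof. by move=> rep y_lt; rewrite rep ?label_lt // exists_label. Qed.

Lemma same_represents a A B rho :
  same_but a A B -> image_arr != a -> represents B rho -> represents A rho.
Proof. by move=> AB a_image rep x y x_lt y_lt; rewrite (bit_same _ _ _ AB) ?rep. Qed.

Definition perm_of A : 'S_n :=
  odflt 1%g [pick rho : 'S_n | [forall i : 'I_n, bit A image_arr (N + i.+1) (rho i).+1]].

Lemma perm_ofE A rho : represents A rho -> perm_of A = rho.
Proof.
move=> rep; rewrite /perm_of; case: pickP => [sigma /forallP sigmaE|/(_ rho)/negP[]].
  apply/permP => i; have := sigmaE i.
  by rewrite (represents_label _ rep) ?label_lt // => /eqP[/val_inj].
by apply/forallP => i; rewrite (represents_label _ rep) ?label_lt.
Qed.

Lemma represents_swap A rho i k : represents A rho -> i != k ->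
  represents (swap_action [:: i.+1; k.+1; (rho i).+1; (rho k).+1] A)
    (tperm i k * rho)%g.
Proof.
move=> rep ik x y x_lt y_lt; rewrite /swap_action !bit_set ?label_lt // !eqn_add2l eqxx /=.
have [l /eqP->|no_label] := pickP (fun l : 'I_n => x == l.+1); last first.
  have -> : [exists l : 'I_n, (x == l.+1) && (y == ((tperm i k * rho)%g l).+1)] = false.
    by apply/existsP => -[l]; rewrite no_label.
  by rewrite !no_label /= rep //; apply/existsP => -[l]; rewrite no_label.
rewrite exists_label (represents_label _ rep) ?label_lt // permM.
rewrite !eqSS !val_eqE; case: tpermP => [->|->|/eqP li /eqP lk].
- rewrite eqxx (negbTE ik) /=; case: (y =P (rho k).+1) => // _.
  by case: eqP.
- rewrite eqxx [k == i]eq_sym (negbTE ik) /=; case: (y =P (rho i).+1) => // _.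
  by case: eqP.
- by rewrite (negbTE li) (negbTE lk).
Qed.

Section Correctness.
Variables (A0 : arrays) (Xs : seq {set 'I_n}).
Hypothesis sets_A0 : forall j x, x < N ->
  bit A0 sets_arr (j + 2) x = [exists i in nth set0 Xs j, x == i.+1].

Definition lt_label : rel 'I_n := relpre label (ordr A0).
Hypotheses (lt_irr : irreflexive lt_label) (lt_trans : transitive lt_label)
  (lt_total : forall i k, i != k -> lt_label i k || lt_label k i)
  (Xs_int : forall B, B \in Xs -> interval lt_label B).

Lemma sets_label j i : bit A0 sets_arr (j + 2) i.+1 = (i \in nth set0 Xs j).
Proof.
rewrite sets_A0 ?label_lt //; apply/exists_inP/idP => [[k kX /eqP[/val_inj->]]|iX] //.
by exists i.
Qed.

Definition sort_inv (answer : bool) (j : nat) A : Prop :=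
  [/\ same_but image_arr A A0, represents A (perm_of A) &
      sym_product (drop j Xs) (perm_of A) = answer].

Definition unsortedness A : nat := n * (n * n) - sortedness lt_label (perm_of A).

Lemma swap_firesE j a b x y A : same_but image_arr A A0 ->
  swap_fires j [:: a; b; x; y] A =
  [&& bit A0 sets_arr (j + 2) a, bit A0 sets_arr (j + 2) b, bit A0 order_arr a b,
      bit A image_arr (N + a) x, bit A image_arr (N + b) y & bit A0 order_arr y x].
Proof.
by move=> AA0; rewrite /= -!(bit_same _ _ _ AA0 (isT : sets_arr != image_arr))
  -!(bit_same _ _ _ AA0 (isT : order_arr != image_arr)).
Qed.

Lemma swap_fires_sound answer j t A :
  t \in tuples N 4 -> sort_inv answer j A -> swap_fires j t A ->
  exists i k, [/\ t = [:: i.+1; k.+1; (perm_of A i).+1; (perm_of A k).+1],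
    i \in nth set0 Xs j, k \in nth set0 Xs j, lt_label i k &
    lt_label (perm_of A k) (perm_of A i)].
Proof.
move=> + [AA0 rep _]; rewrite mem_tuples; case: t => [|a [|b [|x [|y []]]]] // /and5P[].
rewrite swap_firesE //= => _ a_lt b_lt x_lt /andP[y_lt _]; rewrite !sets_A0 //.
case/and5P=> /existsP[i /andP[iX /eqP->]] /existsP[k /andP[kX /eqP->]] ik.
by rewrite !(represents_label _ rep) // => /eqP-> /andP[/eqP-> lt_yx]; exists i, k.
Qed.

Lemma swap_progress answer j t A :
  t \in tuples N 4 -> sort_inv answer j A -> swap_fires j t A ->
  sort_inv answer j (swap_action t A) /\ unsortedness (swap_action t A) < unsortedness A.
Proof.
move=> t_in inv /(swap_fires_sound t_in inv)[i [k [-> iX kX ik rho_ki]]].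
have [AA0 rep answerE] := inv; set rho := perm_of A in rep rho_ki answerE *.
have rep' := represents_swap rep (lt_neq lt_irr ik).
rewrite /unsortedness /sort_inv (perm_ofE rep'); split.
  split=> //; first by do 4!apply: same_but_set.
  rewrite -answerE; case: (ltnP j (size Xs)) => j_lt.
    by rewrite (drop_nth set0 j_lt) sym_product_mul ?tperm_sym.
  by rewrite nth_default // inE in iX.
have := sortedness_swap lt_irr lt_trans ik rho_ki.
have := sortedness_bound lt_label (tperm i k * rho)%g; rewrite card_ord -/rho; lia.
Qed.

Lemma swap_idle answer j A : sort_inv answer j A ->
  {in tuples N 4, forall t, ~~ swap_fires j t A} ->
  sorted_on lt_label (nth set0 Xs j) (perm_of A).
Proof.
move=> [AA0 rep _] idle i k iX kX ik.
apply: (nlt_lt lt_total); first by rewrite (inj_eq perm_inj) eq_sym (lt_neq lt_irr).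
apply/negP => rho_ki.
set t := [:: i.+1; k.+1; (perm_of A i).+1; (perm_of A k).+1].
have /idle/negP[] : t \in tuples N 4 by rewrite mem_tuples /= !label_lt.
rewrite swap_firesE // !sets_label iX kX.
rewrite !(represents_label _ rep) ?label_lt // !eqxx.
by move: ik rho_ki; rewrite /lt_label /= /ordr /= => -> ->.
Qed.

Lemma sort_stage_spec m rho :
  arrs m = A0 -> size Xs <= N -> represents A0 rho ->
  let A := arrs (exec sort_stage m) in
  [/\ same_but image_arr A A0, represents A (perm_of A) &
      (perm_of A == 1%g) = sym_product Xs rho].
Proof.
move=> mE size_Xs rep; set answer := sym_product Xs rho.
suff : sort_inv answer N (arrs (exec sort_stage m)).
  by case=> AA0 repA; rewrite drop_oversize.
apply: (@exec_for S N (fun j m' => sort_inv answer j (arrs m'))) => //=.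
  by rewrite mE; split; rewrite ?drop0 ?(perm_ofE rep).
move=> j m' j_lt jE inv.
have [||||inv' idle] := @repeat_saturates S N [:: var_a; var_b; var_x; var_y] swap_rule
    (swap_fires j) swap_action (sort_inv answer j) unsortedness
    (EAdd (EMul ESize (EMul ESize ESize)) (EConst 1)) m' erefl erefl.
- by move=> m'' vars_m'' _; apply: exec_swap_rule; rewrite vars_m''.
- by move=> t A; apply: swap_progress.
- by [].
- by rewrite /= addn1 ltnS (leq_trans (leq_subr _ _)) // !leq_mul // ltnW.
have [AA0 repA <-] := inv'; split=> //.
case: (ltnP j (size Xs)) => j_ltX; last by rewrite !drop_oversize // ltnW.
rewrite (drop_nth set0 j_ltX) (sym_product_sorted lt_irr) //.
  by move=> B /mem_drop; apply: Xs_int.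
exact: swap_idle inv' idle.
Qed.

End Correctness.

Definition verdict_rule : cmd S :=
  CIfAll [:: image_test var_a var_x true; image_test var_a var_a false]
    (CWrite reject_arr (EConst 0) (mark true)) CSkip.

Definition verdict_stage : cmd S := nest [:: var_a; var_x] verdict_rule.

Definition moved t A : bool :=
  if t is [:: a; x] then bit A image_arr (N + a) x && ~~ bit A image_arr (N + a) a else false.

Definition reject t A : arrays := set_cell A reject_arr 0 (mark true).

Lemma sweep_reject ts A :
  sweep moved reject ts A reject_arr 0 =
  if has (moved^~ A) ts then mark true else A reject_arr 0.
Proof.
rewrite /sweep; elim: ts A => //= t ts IH A; rewrite IH /fire.
by case: (moved t A) => //=; case: ifP.
Qed.

Lemma verdict_stage_spec m rho :
  represents (arrs m) rho -> arrs m reject_arr 0 = mark false ->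
  (arrs (exec verdict_stage m) reject_arr 0 != mark true) = (rho == 1%g).
Proof.
move=> rep no_reject.
rewrite (@exec_nest S N _ verdict_rule (fire moved reject)) // => [|m' _ _]; last first.
  rewrite /verdict_rule exec_ifall /= /holds /= -!/(bit _ _ _ _) eqb_id eqbF_neg andbT.
  by rewrite /fire /moved /=; case: ifP; rewrite !execE.
rewrite -/(sweep _ _ _ _) sweep_reject no_reject.
rewrite (_ : (_ != _) = ~~ has (moved^~ (arrs m)) (tuples N 2)); last by case: has.
apply/hasPn/eqP => [fixed|rho1 t].
  apply/permP => i; rewrite perm1; apply/eqP.
  have /fixed : [:: i.+1; (rho i).+1] \in tuples N 2.
    by rewrite mem_tuples /= !label_lt.
  rewrite /= !(represents_label _ rep) ?label_lt // eqxx negbK.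
  by move=> /eqP[/val_inj<-].
case: t => [|a [|x []]] //; rewrite mem_tuples => /and4P[_ a_lt x_lt _].
rewrite /= !rep // rho1; apply/negP => /andP[/existsP[i /andP[/eqP aE _]] /existsP[]].
by exists i; rewrite perm1 aE eqxx.
Qed.

End SortStage.

(** * Parsing the input *)

Notation var_pos := 0 (only parsing).
Notation var_list := 1 (only parsing).
Notation var_item := 2 (only parsing).
Notation var_value := 3 (only parsing).
Notation var_weight := 4 (only parsing).

Lemma modn_exp2S k i : k %% 2 ^ i.+1 = k %% 2 ^ i + odd (k %/ 2 ^ i) * 2 ^ i.
Proof.
rewrite {1}(divn_eq (k %% 2 ^ i.+1) (2 ^ i)) modn_dvdm ?dvdn_exp2l //.
by rewrite expnS -modn_divl modn2 addnC.
Qed.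

(* The numbers in a list of lists, each after the index of its list and its
   position in this list, counted from 1. *)
Fixpoint list_entries (l k : nat) (s : seq nat) : seq (nat * nat * nat) :=
  if s is v :: s' then (l, k, v) :: list_entries l k.+1 s' else [::].

Fixpoint entries (l : nat) (ls : seq (seq nat)) : seq (nat * nat * nat) :=
  if ls is s :: ls' then list_entries l 1 s ++ entries l.+1 ls' else [::].

Lemma mem_list_entries l' k v l c s : ((l', k, v) \in list_entries l c s) =
  [&& l' == l, c <= k < c + size s & nth 0 s (k - c) == v].
Proof.
elim: s c => [|u s IH] c /=; first by rewrite addn0 ltnNge andbN andbF.
rewrite inE IH !xpair_eqE; case: (l' =P l) => //= _.
case: (ltngtP k c) => [k_lt|k_gt|->]; rewrite /= ?orbF ?addnS.
- by lia.
- by rewrite (_ : k - c = (k - c.+1).+1) /=; [congr andb|]; lia.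
- by rewrite subnn leq_addr eq_sym.
Qed.

Lemma mem_entries l' k v l ls : ((l', k, v) \in entries l ls) =
  [&& l <= l' < l + size ls, 0 < k <= size (nth [::] ls (l' - l)) &
      nth 0 (nth [::] ls (l' - l)) k.-1 == v].
Proof.
elim: ls l => [|s ls IH] l /=; first by rewrite addn0 leqNgt andNb.
rewrite mem_cat mem_list_entries IH; case: (ltngtP l' l) => [l_lt|l_gt|->] //=.
- by rewrite (_ : l' - l = (l' - l.+1).+1) /=; [rewrite addnS|lia].
- by rewrite subnn orbF add1n subn1 addnS ltnS leq_addr.
Qed.

Definition parse_symbol : cmd symbol :=
  CIf 0 (EVar var_pos) (inl (digit true))
    (CSeq (CSet var_value (EAdd (EVar var_value) (EVar var_weight)))
          (CSet var_weight (EAdd (EVar var_weight) (EVar var_weight))))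
 (CIf 0 (EVar var_pos) (inl (digit false))
    (CSet var_weight (EAdd (EVar var_weight) (EVar var_weight)))
 (CIf 0 (EVar var_pos) (inl comma)
    (CSeq (CWrite sets_arr (entry (EVar var_list) (EVar var_value)) (mark true))
    (CSeq (CWrite image_arr
             (entry (entry (EVar var_list) (EVar var_item)) (EVar var_value)) (mark true))
    (CSeq (CSet var_item (EAdd (EVar var_item) (EConst 1)))
    (CSeq (CSet var_value (EConst 0))
          (CSet var_weight (EConst 1))))))
    (CSeq (CSet var_list (EAdd (EVar var_list) (EConst 1)))
          (CSet var_item (EConst 1))))).

Definition parse_stage : cmd symbol :=
  CSeq (CSet var_item (EConst 1))
 (CSeq (CSet var_weight (EConst 1))
       (CFor var_pos ESize parse_symbol)).

Section Parsing.
Variable N : nat.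
Hypothesis N_gt0 : 0 < N.
Notation exec := (@exec symbol N).

Record parse_state := ParseState
  { list_ix : nat; item_ix : nat; value : nat; weight : nat; read : seq (nat * nat * nat) }.

Definition parse_step (p : parse_state) (s : symbol) : parse_state :=
  let: ParseState l k v w r := p in
  match s with
  | inl true => ParseState l k (minn (v + w) N) (minn (w + w) N) r
  | inl false => ParseState l k v (minn (w + w) N) r
  | inr false => ParseState l (minn (k + 1) N) (minn 0 N) (minn 1 N) ((l, k, v) :: r)
  | inr true => ParseState (minn (l + 1) N) (minn 1 N) v w r
  end.

Definition parse_start : parse_state := ParseState 0 1 0 1 [::].

Definition sets_ix (u : nat * nat * nat) : nat := u.1.1 * N + u.2.
Definition image_ix (u : nat * nat * nat) : nat := (u.1.1 * N + u.1.2) * N + u.2.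

Definition parse_rep (w : seq symbol) (p : parse_state) (m : memory symbol) : Prop :=
  [/\ [/\ vars m var_list = list_ix p, vars m var_item = item_ix p,
          vars m var_value = value p & vars m var_weight = weight p],
      arrs m 0 =1 nth (mark false) (map inl w),
      forall i, arrs m sets_arr i = mark (i \in map sets_ix (read p)),
      forall i, arrs m image_arr i = mark (i \in map image_ix (read p)) &
      forall a, a \notin [:: 0; sets_arr; image_arr] -> arrs m a =1 fun=> mark false].

Lemma parse_symbol_spec w p m :
  vars m var_pos < size w -> parse_rep w p m ->
  parse_rep w (parse_step p (nth comma w (vars m var_pos))) (exec parse_symbol m).
Proof.
case: p => l k v c r pos_lt [[/= lE kE vE cE] inputE setsE imageE otherE].
have symbolE : arrs m 0 (vars m var_pos) = inl (nth comma w (vars m var_pos)).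
  by rewrite inputE (nth_map comma).
rewrite /parse_symbol !execE /= !symbolE; case: (nth comma w _) => -[] /=; rewrite ?eqxx.
- by split=> //=; rewrite vE cE.
- by split=> //=; rewrite cE.
- by split=> //=; rewrite lE.
split=> //=; rewrite ?lE ?kE // /set_cell /=.
- by move=> i; rewrite setsE inE vE; case: eqP.
- by move=> i; rewrite imageE inE vE; case: eqP.
- move=> a a_notin i; rewrite -(otherE a a_notin i); move: a_notin.
  by rewrite !inE !negb_or => /and3P[_ /negbTE-> /negbTE->].
Qed.

Lemma parse_stage_spec w : size w = N ->
  parse_rep w (foldl parse_step parse_start w) (exec parse_stage (init_mem w)).
Proof.
move=> size_w; rewrite /parse_stage !execE /=.
rewrite (minn_idPl N_gt0); set m0 := set_var _ var_weight 1.
suff : parse_rep w (foldl parse_step parse_start (take N w))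
    (exec (CFor var_pos ESize parse_symbol) m0).
  by rewrite take_oversize // size_w.
apply: (@exec_for _ N (fun i => parse_rep w (foldl parse_step parse_start (take i w)))) => //.
  rewrite take0; split=> //= a; rewrite inE negb_or => /andP[/negbTE a_input _] i.
  by rewrite a_input.
move=> i m i_lt pos_i rep; have pos_lt : vars m var_pos < size w by rewrite pos_i size_w.
have := parse_symbol_spec pos_lt rep; rewrite pos_i (take_nth comma) ?size_w // foldl_rcons.
by case=> -[].
Qed.

Lemma foldl_digits k n l c r : k <= N ->
  foldl parse_step (ParseState l c 0 1 r) (map digit (mkseq (fun i => odd (k %/ 2 ^ i)) n)) =
  ParseState l c (k %% 2 ^ n) (minn (2 ^ n) N) r.
Proof.
move=> k_le; elim: n => [|n IH]; first by rewrite /= modn1 expn0 (minn_idPl N_gt0).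
rewrite mkseqS map_rcons foldl_rcons IH.
have weightE : minn (minn (2 ^ n) N + minn (2 ^ n) N) N = minn (2 ^ n.+1) N.
  by rewrite expnS; lia.
have := leq_trans (leq_mod k (2 ^ n.+1)) k_le; rewrite modn_exp2S => value_le.
rewrite /= weightE; case: (odd _) value_le => /= value_le; congr ParseState; lia.
Qed.

Lemma foldl_encode_nat k l c r : k <= N ->
  foldl parse_step (ParseState l c 0 1 r) (encode_nat k) =
  ParseState l (minn (c + 1) N) 0 1 ((l, c, k) :: r).
Proof.
move=> k_le; rewrite /encode_nat foldl_rcons foldl_digits //=.
by rewrite modn_small ?trunc_log_ltn // (minn_idPl N_gt0) min0n.
Qed.

Lemma foldl_encode_nats s l c r : all (leq^~ N) s -> c + size s <= N ->
  foldl parse_step (ParseState l c 0 1 r) (flatten (map encode_nat s)) =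
  ParseState l (c + size s) 0 1 (catrev (list_entries l c s) r).
Proof.
elim: s c r => [|v s IH] c r; first by rewrite addn0.
rewrite [all _ _]/= [size (_ :: _)]/= => /andP[v_le s_le] size_le.
rewrite -[flatten _]/(encode_nat v ++ flatten (map encode_nat s)).
rewrite foldl_cat foldl_encode_nat // (minn_idPl _) ?addn1; last by lia.
by rewrite IH ?addSnnS.
Qed.

Lemma foldl_encode_lists ls l r :
  all (fun s => all (leq^~ N) s && (size s < N)) ls -> l + size ls <= N ->
  foldl parse_step (ParseState l 1 0 1 r) (flatten (map encode_list ls)) =
  ParseState (l + size ls) 1 0 1 (catrev (entries l ls) r).
Proof.
elim: ls l r => [|s ls IH] l r; first by rewrite addn0.
rewrite [all _ _]/= [size (_ :: _)]/= => /andP[/andP[s_le size_s] ls_le] size_le.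
rewrite -[flatten _]/(encode_list s ++ flatten (map encode_list ls)).
rewrite foldl_cat foldl_rcons foldl_encode_nats //.
rewrite [parse_step _ _]/= (minn_idPl N_gt0) (minn_idPl _) ?addn1; last by lia.
by rewrite IH ?addSnnS // catrev_catl.
Qed.

End Parsing.

(** * Correctness of the algorithm *)

Definition wppsg_cmd : cmd symbol :=
  CSeq parse_stage
 (CSeq (order_stage symbol)
 (CSeq (sort_stage symbol) (verdict_stage symbol))).

Lemma size_encode_list s : 2 * size s < size (encode_list s).
Proof.
rewrite /encode_list size_rcons ltnS; elim: s => // v s IH.
have : 1 < size (encode_nat v) by rewrite size_rcons size_map /binary size_mkseq.
rewrite -[flatten _]/(encode_nat v ++ flatten (map encode_nat s)) size_cat [size (v :: s)]/=.
by lia.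
Qed.

Lemma size_encode_lists ls :
  size ls + 2 * sumn (map size ls) <= size (flatten (map encode_list ls)).
Proof.
elim: ls => // s ls IH.
rewrite -[flatten _]/(encode_list s ++ flatten (map encode_list ls)) size_cat.
by rewrite [sumn _]/= [size (s :: ls)]/=; have := size_encode_list s; lia.
Qed.

Lemma size_map_ord (T : Type) k (f : 'I_k -> T) : size [seq f i | i <- enum 'I_k] = k.
Proof. by rewrite size_map size_enum_ord. Qed.

Lemma nth_map_ord (T : Type) (d : T) k (f : 'I_k -> T) (j : 'I_k) :
  nth d [seq f i | i <- enum 'I_k] j = f j.
Proof. by rewrite (nth_map j) ?size_enum_ord // nth_ord_enum. Qed.

Section Instance.
Variable x : wppsg_instance.
Let n := wp_n x.
Let w := wppsg_encode x.
Let N := size w.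
Let rho := wp_target x.
Let Xs := [seq wp_set j | j <- enum 'I_(wp_m x)].

Definition target_list : seq nat := [seq (rho i).+1 | i <- enum 'I_n].
Definition set_list (B : {set 'I_n}) : seq nat := [seq i.+1 | i : 'I_n <- enum B].
Definition instance_lists : seq (seq nat) :=
  [:: n; wp_m x] :: target_list :: map set_list Xs.

Lemma wppsg_encodeE : w = flatten (map encode_list instance_lists).
Proof.
rewrite /w /wppsg_encode /instance_lists /Xs !map_cons -[map encode_list (map _ _)]map_comp.
by rewrite -[map (encode_list \o _) _]map_comp.
Qed.

Lemma instance_size : n + wp_m x + 4 < N.
Proof.
have := size_encode_lists instance_lists; rewrite -wppsg_encodeE -/N /=.
by rewrite size_map !size_map_ord; lia.
Qed.

Lemma n_lt_size : n < N.
Proof. by have := instance_size; lia. Qed.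

Lemma size_Xs : size Xs <= N.
Proof. by rewrite size_map_ord; have := instance_size; lia. Qed.

Lemma instance_lists_bound s :
  s \in instance_lists -> all (ltn^~ N) s && (size s < N).
Proof.
have := instance_size; have := n_lt_size => n_lt size_lt.
have labels_lt (I : eqType) (r : seq I) (f : I -> 'I_n) : all (ltn^~ N) [seq (f i).+1 | i <- r].
  by rewrite all_map; apply/allP => i _ /=; apply: leq_ltn_trans (ltn_ord _) n_lt.
rewrite !inE => /or3P[/eqP->|/eqP->|/mapP[B _ ->]].
- by rewrite /=; lia.
- by rewrite labels_lt size_map_ord.
- by rewrite labels_lt size_map -cardE (leq_ltn_trans (max_card _)) ?card_ord.
Qed.

Lemma mem_entries_bound l k v : (l, k, v) \in entries 0 instance_lists -> k < N /\ v < N.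
Proof.
rewrite mem_entries subn0 => /and3P[/andP[_ l_lt] /andP[k_gt0 k_le] /eqP<-].
have /andP[/allP s_lt size_s] := instance_lists_bound (mem_nth [::] l_lt).
split; first exact: leq_ltn_trans k_le size_s.
by apply/s_lt/mem_nth; rewrite prednK.
Qed.

Definition parsed : nat -> nat -> cell symbol := arrs (exec N parse_stage (init_mem w)).

Lemma parsed_rep :
  [/\ forall i, parsed sets_arr i = mark (i \in map (sets_ix N) (entries 0 instance_lists)),
      forall i, parsed image_arr i = mark (i \in map (image_ix N) (entries 0 instance_lists)) &
      forall a, a \notin [:: 0; sets_arr; image_arr] -> parsed a =1 fun=> mark false].
Proof.
have size_lt := instance_size; have N_gt0 : 0 < N by lia.
have [_ _ setsE imageE otherE] := parse_stage_spec N_gt0 (erefl N : size w = N).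
have readE : read (foldl (parse_step N) parse_start w) = rev (entries 0 instance_lists).
  rewrite [in X in foldl _ _ X]wppsg_encodeE foldl_encode_lists //.
    apply/allP => s /instance_lists_bound/andP[/allP s_lt ->]; rewrite andbT.
    by apply/allP => v /s_lt/ltnW.
  by rewrite /= size_map size_map_ord; lia.
by split=> // i; rewrite /parsed ?setsE ?imageE readE map_rev mem_rev.
Qed.

Lemma parsed_sets l v : v < N ->
  bit N parsed sets_arr l v = (l < size instance_lists) && (v \in nth [::] instance_lists l).
Proof.
move=> v_lt; have [setsE _ _] := parsed_rep.
rewrite /bit setsE mark_true; apply/mapP/andP => [[[[l' k] v'] lkv ixE]|[l_lt v_in]].
  have [_ v'_lt] := mem_entries_bound lkv; move/eqP: ixE.
  rewrite /sets_ix eq_entry // => /andP[/eqP-> /eqP->].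
  move: lkv; rewrite mem_entries subn0 => /and3P[/andP[_ ->] /andP[k_gt0 k_le] /eqP<-].
  by split=> //; apply: mem_nth; rewrite prednK.
exists (l, (index v (nth [::] instance_lists l)).+1, v) => //.
by rewrite mem_entries subn0 add0n l_lt /= index_mem v_in nth_index ?eqxx.
Qed.

Lemma parsed_image l k v : k < N -> v < N ->
  bit N parsed image_arr (l * N + k) v = ((l, k, v) \in entries 0 instance_lists).
Proof.
move=> k_lt v_lt; have [_ imageE _] := parsed_rep.
rewrite /bit imageE mark_true.
apply/mapP/idP => [[[[l' k'] v'] lkv ixE]|lkv]; last by exists (l, k, v).
have [k'_lt v'_lt] := mem_entries_bound lkv; move/eqP: ixE.
rewrite /image_ix eq_entry // => /andP[/= + /eqP->].
by rewrite eq_entry // => /andP[/eqP-> /eqP->].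
Qed.

Lemma parsed_represents : represents N parsed rho.
Proof.
move=> k v k_lt v_lt; have := parsed_image 1 k_lt v_lt; rewrite mul1n => ->.
rewrite mem_entries subn0.
rewrite [size instance_lists]/= [nth [::] _ _]/= size_map_ord /=.
apply/andP/existsP => [[/andP[k_gt0 k_le] /eqP<-]|[i /andP[/eqP-> /eqP->]]].
  have k_pred : k.-1 < n by rewrite prednK.
  exists (Ordinal k_pred); rewrite -[k.-1]/(val (Ordinal k_pred)) nth_map_ord /= prednK //.
  by rewrite !eqxx.
by rewrite ltn_ord -[i.+1.-1]/(val i) nth_map_ord eqxx.
Qed.

Lemma parsed_member j v : v < N ->
  bit N parsed sets_arr (j + 2) v = [exists i in nth set0 Xs j, v == i.+1].
Proof.
move=> v_lt; rewrite parsed_sets // addn2 [size _]/= !ltnS size_map /=.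
have [j_lt|j_ge] := ltnP j (size Xs); last first.
  by rewrite [nth set0 Xs j]nth_default //; apply/esym/exists_inP => -[i]; rewrite inE.
rewrite (nth_map set0) //=; apply/mapP/exists_inP => [[i]|[i i_in /eqP->]].
  by rewrite mem_enum => i_in ->; exists i.
by exists i => //; rewrite mem_enum.
Qed.

Definition label_seq (pi : 'S_n) : seq nat := [seq (pi p).+1 | p <- enum 'I_n] ++ iota 0 N.

Lemma index_label (pi : 'S_n) (i : 'I_n) : index i.+1 (label_seq pi) = (pi^-1 i)%g.
Proof.
have label_pi_inj : injective (fun p => (pi p).+1) by move=> p1 p2 [/val_inj/perm_inj].
rewrite -{1}(permKV pi i) index_cat (map_f (fun p => (pi p).+1)) ?mem_enum //.
by rewrite (index_map label_pi_inj) index_enum_ord.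
Qed.

(* The numbers [0, n + 1, ..., N - 1] belong to no set and are put at the end. *)
Lemma index_unlabelled (pi : 'S_n) v :
  (forall i : 'I_n, v != i.+1) -> n <= index v (label_seq pi).
Proof.
move=> no_label; rewrite index_cat ifN ?size_map_ord ?leq_addr //.
by apply/mapP => -[p _ vE]; have := no_label (pi p); rewrite vE eqxx.
Qed.

Lemma parsed_consecutive (pi : 'S_n) :
  (forall (j : 'I_(wp_m x)) (p q r : 'I_n), p <= q <= r ->
     pi p \in wp_set j -> pi r \in wp_set j -> pi q \in wp_set j) ->
  forcing_closed (member parsed)
    (fun u v : 'I_N => index (u : nat) (label_seq pi) < index (v : nat) (label_seq pi)).
Proof.
move=> consecutive; apply: key_forcing_closed => j u v t.
rewrite /member !parsed_member // => /exists_inP[a aX /eqP->] /exists_inP[c cX /eqP->].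
rewrite !index_label => v_between.
have /existsP[b /eqP vE] : [exists b : 'I_n, v == b.+1 :> nat].
  apply: contraT => /existsPn/(index_unlabelled pi); rewrite leqNgt.
  by case/andP: v_between => _ /leq_ltn_trans->.
rewrite vE index_label in v_between *; apply/exists_inP; exists b => //.
have [j_lt|j_ge] := ltnP j (wp_m x); last by rewrite nth_default ?inE ?size_map_ord in aX.
rewrite -[val j]/(val (Ordinal j_lt)) !nth_map_ord in aX cX *.
rewrite -(permKV pi b); apply: consecutive v_between _ _; by rewrite permKV.
Qed.

Lemma parsed_forced_asym (a b : 'I_N) : consecutive_ones x -> a != b ->
  forall u v, forced (member parsed) a b u v -> ~ forced (member parsed) a b v u.
Proof.
move=> [pi /parsed_consecutive pi_closed] ab u v; apply: forced_asym pi_closed _ _.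
  by move=> y z yz zy; have := ltn_trans yz zy; rewrite ltnn.
have in_seq (y : 'I_N) : (y : nat) \in label_seq pi by rewrite mem_cat mem_iota ltn_ord orbT.
apply/orP; rewrite -neq_ltn; apply: contra ab => /eqP indexE; apply/eqP/ord_inj.
by rewrite -(nth_index 0 (in_seq a)) indexE nth_index.
Qed.

Lemma good_order_interval A B :
  good_order N parsed A -> B \in Xs -> interval (lt_label n_lt_size A) B.
Proof.
move=> [_ irr tr closed] /(nthP set0)[j j_lt <-] a b c ab bc.
have j_N : j < N := leq_trans j_lt size_Xs.
rewrite -!(sets_label n_lt_size parsed_member) => aX cX.
pose e : 'I_n -> 'I_N := label n_lt_size.
apply: (@forcing_closed_between _ _ _ _ (Ordinal j_N) (e a) (e b) (e c) closed) aX cX ab bc.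
  by move=> u; rewrite irr.
by move=> u v t; apply: tr.
Qed.

Lemma wppsg_yesE : wppsg_yes x <-> sym_product Xs rho.
Proof.
rewrite -(sym_productP _ _ (enum_uniq 'I_(wp_m x))).
by rewrite (_ : enum 'I_(wp_m x) = index_enum 'I_(wp_m x)) // [index_enum _]unlock enumT.
Qed.

Lemma wppsg_cmd_correct : consecutive_ones x ->
  arrs (exec N wppsg_cmd (init_mem w)) reject_arr 0 != mark true <-> wppsg_yes x.
Proof.
move=> x_consecutive; rewrite /wppsg_cmd !execE wppsg_yesE.
have [_ _ empty] := parsed_rep.
have [good total] := order_stage_spec
  (fun a b => @parsed_forced_asym a b x_consecutive) (empty order_arr isT).
set m2 := exec N (order_stage symbol) _ in good total *.
have [ordered irr tr _] := good.
have sets_m2 j v : v < N ->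
    bit N (arrs m2) sets_arr (j + 2) v = [exists i in nth set0 Xs j, v == i.+1].
  by move=> v_lt; rewrite -parsed_member //; apply: bit_same ordered _.
have rep_m2 : represents N (arrs m2) rho by apply: same_represents ordered _ parsed_represents.
have lt_total (i k : 'I_n) : i != k ->
    lt_label n_lt_size (arrs m2) i k || lt_label n_lt_size (arrs m2) k i.
  by rewrite -(inj_eq (@label_inj N n n_lt_size)) => /total.
have [sorted rep_sorted verdictE] := sort_stage_spec sets_m2
  (fun i => irr _) (fun i k l => tr _ _ _) lt_total
  (fun B => @good_order_interval _ B good) (erefl (arrs m2)) size_Xs rep_m2.
have no_reject : arrs (exec N (sort_stage symbol) m2) reject_arr 0 = mark false.
  by rewrite sorted // ordered //; apply: empty.
by rewrite (verdict_stage_spec n_lt_size rep_sorted no_reject) verdictE.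
Qed.

End Instance.

Theorem theorem4p3 : polytime_solvable WPPSG1.
Proof.
apply: (@cmd_polytime WPPSG1 wppsg_cmd reject_arr) => -[x x_consecutive].
exact: wppsg_cmd_correct.
Qed.
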